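(* Let $X$ be a real Banach space and let $\varphi:X\to X$ be a homeomorphism with $\varphi(0)=0$ whose inverse $\varphi^{-1}$ is Lipschitz with constant $k$. Assume that $f:[0,1]\times X\times X\to X$ is continuous and satisfies the following conditions. (1) There exist two numbers $c_0,c_1\ge 0$ such that $\|f(t,x,y)\|\le c_0+c_1\|y\|$ for all $(t,x,y)\in[0,1]\times X\times X$. (2) There is a constant $k_1$ with $0<k_1<\frac{1}{2k}$ such that, for all bounded subsets $A,B$ of $X$, $$\alpha\big(f([0,1]\times A\times B)\big)\le k_1\max\{\alpha(A),\alpha(B)\}.$$ Then the boundary value problem $$(\varphi(u'))'=f(t,u,u'),\qquad u(1)=0=u'(0)$$ has at least one solution.
   Context: $\alpha$ denotes the Kuratowski measure of noncompactness: for a bounded set $B\subset X$, $\alpha(B)=\inf\{d>0: B\text{ admits a finite cover by sets of diameter}\le d\}$. That $\varphi^{-1}$ is Lipschitz with constant $k$ means $k>0$ and $\|\varphi^{-1}(x)-\varphi^{-1}(y)\|\le k\|x-y\|$ for all $x,y\in X$. A solution of the boundary value problem is a function $u:[0,1]\to X$ of class $C^1$ such that $t\mapsto\varphi(u'(t))$ is continuously differentiable, $u(1)=0=u'(0)$, and $(\varphi(u'(t)))'=f(t,u(t),u'(t))$ for all $t\in[0,1]$. *)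

(* Defs.v *)
From HB Require Import structures.
From mathcomp Require Import all_boot all_order all_algebra.
From mathcomp Require Import all_classical all_reals all_analysis.
Set Implicit Arguments.
Unset Strict Implicit.
Unset Printing Implicit Defensive.
Import Order.TTheory GRing.Theory Num.Theory numFieldNormedType.Exports.
Local Open Scope classical_set_scope.
Local Open Scope ring_scope.

Section Noncompactness.
Context {R : realType} {X : normedModType R}.

(* [diameter set0 = -oo], so the empty set has diameter at most [d] for every
   real [d]. *)
Definition diameter (C : set X) : \bar R :=
  ereal_sup [set (`|p.1 - p.2|)%:E | p in C `*` C].

(* The real infimum [inf] is 0 by convention on the empty set, so the value is
   meaningful only when [B] is bounded. *)
Definition kuratowski (B : set X) : R :=
  inf [set d : R | 0 < d /\
        exists F : set (set X),
          [/\ finite_set F,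
              B `<=` \bigcup_(C in F) C
            & forall C, F C -> (diameter C <= d%:E)%E]].

End Noncompactness.

Definition homeomorphism {T U : topologicalType} (phi : T -> U) (psi : U -> T)
  : Prop :=
  [/\ continuous phi, continuous psi, cancel phi psi & cancel psi phi].

(* A function on [0, 1] is represented by a function on R, of which only the
   values on [0, 1] matter. *)
Definition unit_interval (R : realType) : set R := `[0, 1]%classic.
Arguments unit_interval R : clear implicits.

Section Solutions.
Context {R : realType} {X : normedModType R}.

(* The limit is taken along points [s] of [A] distinct from [t]; when [A] is an
   interval, this is a one-sided derivative at the endpoints that belong to
   [A]. *)
Definition has_derivative_within (A : set R) (g : R -> X) (t : R) (l : X)
  : Prop :=
  (s - t)^-1 *: (g s - g t) @[s --> within A t^'] --> l.

Definition C1_within (A : set R) (g g' : R -> X) : Prop :=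
  (forall t, A t -> has_derivative_within A g t (g' t)) /\
  {within A, continuous g'}.

Definition bvp_solution (phi : X -> X) (f : R * X * X -> X) (u : R -> X)
  : Prop :=
  exists u' w : R -> X,
    [/\ C1_within (unit_interval R) u u',
        C1_within (unit_interval R) (phi \o u') w,
        u 1 = 0 /\ u' 0 = 0
      & forall t, unit_interval R t -> w t = f (t, u t, u' t)].

End Solutions.

(* Main.v *)
Require Import Defs.
From HB Require Import structures.
From mathcomp Require Import all_boot all_order all_algebra.
From mathcomp Require Import all_classical all_reals all_analysis.
From mathcomp Require Import ring lra.

(** Write [psi] for the inverse of [phi] and put [v = u'], [w = phi v]. The
    problem becomes the first order system [u' = psi w], [w' = f (t, u, psi w)]
    with [w 0 = 0] and [u 1 = 0]. The only unknown initial datum is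
    [b = - u 0], and the condition at time [1] says that [b] is the integral of
    [v]: a fixed point equation in [X].

    The growth of [f] bounds [w], hence [v], by Gronwall's inequality. Beyond
    that bound, [f] may be replaced by [f (t, x, radial M y)], which is bounded.
    Let then [K] be the smallest closed convex set that contains [0] and
    [psi @` W], where [W] is the convex hull of [0] and the values of the
    truncated [f] for [x] in [K - K] and [y] in [K]. Riemann sums over
    subintervals of the unit interval are averages of values and of [0]. So if
    [b] is in [K] and integrals are replaced by such sums, then [w] stays in
    [W], [v] in [K], [u] in [K - K], and the sum for the integral of [v] is in
    [K] ([euler_in]). By minimality [K] is the closed convex hull of [0] and
    [psi @` W], and the measure of noncompactness is insensitive to closed
    convex hulls ([covered_closed_hull]). Therefore
    [alpha K <= k * k1 * max (alpha (K - K)) (alpha K) <= 2 * k * k1 * alpha K],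
    where the last term is smaller than [alpha K] unless [alpha K = 0]. So [K]
    is compact ([compact_invariant]).

    The system is discretised by Euler's method with [n.+1] steps, for which
    [b] is mapped to the sum of the increments of [u], a continuous self-map of
    [K]. It has almost fixed points by Schauder's theorem
    ([approximate_fixed_point]), which is derived here from a lemma of Scarf on
    families of linear orders ([scarf]), proved by a parity argument: a grid on
    the simplex spanned by a net of [K] is labelled by the vertices of the net
    near the images of the grid points, and a completely labelled cell is an
    almost fixed point.

    Finally the polygons converge pointwise along an ultrafilter, because their
    values lie in compact sets. The increments of the limits are controlled by
    the slopes of the polygons, which yields the derivatives of [u] and of
    [phi v] ([polygon_C1], [shooting_limit]). *)

Set Implicit Arguments.
Unset Strict Implicit.
Unset Printing Implicit Defensive.

(** * A lemma of Scarf on families of linear orders *)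

Section Scarf.
Import ssrnat fintype boot.finset.
Variables (I V : finType) (r : I -> V -> nat).
Hypothesis r_inj : forall i, injective (r i).
Variable v0 : V.
Implicit Types (s t : {set V}) (C D : {set I}).

Definition below i y s := [forall x in s, r i y <= r i x].

(** Think of [V] as a fine grid in a simplex and of [r i] as the [i]-th
    coordinate: a dominant pair with [#|s| = #|C|] behaves like a small simplex
    lying near the face [C], and one with [#|C| = #|s|.+1] like a wall between
    two of those. *)
Definition dominant s C := [forall y, exists i in C, below i y s].

Lemma belowP i y s : reflect {in s, forall x, r i y <= r i x} (below i y s).
Proof. exact: 'forall_implyP. Qed.

Lemma dominantP s C :
  reflect (forall y, exists2 i, i \in C & below i y s) (dominant s C).
Proof.
by apply: (iffP forallP) => H y; move/(_ y): H => /exists_inP.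
Qed.

Lemma below_sub i y s t : s \subset t -> below i y t -> below i y s.
Proof.
by move=> st /belowP yt; apply/belowP => x /(subsetP st)/yt.
Qed.

Lemma below_uniq i s : {in s &, forall x y, below i x s -> below i y s -> x = y}.
Proof.
move=> x y xs ys /belowP/(_ _ ys) xy /belowP/(_ _ xs) yx.
by apply: (@r_inj i); apply/eqP; rewrite eqn_leq xy yx.
Qed.

Lemma dominant_sub s t C D :
  s \subset t -> C \subset D -> dominant t C -> dominant s D.
Proof.
move=> st CD /dominantP dom; apply/dominantP => y.
have [i iC yi] := dom y; exists i; first exact: (subsetP CD).
exact: below_sub yi.
Qed.

Lemma dominant_neq0 s C : dominant s C -> C != set0.
Proof.
by move=> /dominantP/(_ v0) [i iC _]; apply/set0Pn; exists i.
Qed.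

Definition attains s C := [forall z in s, exists i in C, below i z s].

Lemma attainsP s C :
  reflect {in s, forall z, exists2 i, i \in C & below i z s} (attains s C).
Proof.
apply: (iffP 'forall_implyP) => H z zs; move: (H z zs) => /exists_inP//.
Qed.

Lemma dominant_attains s C : dominant s C -> attains s C.
Proof. by move=> /dominantP dom; apply/attainsP => z _; exact: dom. Qed.

(** One index is minimal at one point only, since its rank is injective. *)
Lemma attains_leq_card s C : attains s C -> #|s| <= #|C|.
Proof.
move=> /attainsP att.
pose m i := odflt v0 [pick z in s | below i z s].
suff : s \subset m @: C by move/subset_leq_card/leq_trans; apply; exact: leq_imset_card.
apply/subsetP => z zs; have [i iC zi] := att z zs; apply/imsetP; exists i => //.
rewrite /m; case: pickP => [y /andP[ys yi]|/(_ z)] /=; last by rewrite zs zi.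
exact: (@below_uniq i s).
Qed.

(** Each of these indices is an exit through the wall [(s, C)]: giving it up
    leads to exactly one neighbouring cell. *)
Definition redundant s C := [set i in C | attains s (C :\ i)].

Definition above i s C :=
  [pred x | [forall l in C :\ i, ~~ below l x s]].

(** Leaving the wall [(s, C)] through [i]: among the points that only [i] keeps
    from contradicting dominance, the highest for [i] joins [s]; when there are
    none, [s] is already dominant for [C :\ i]. The value [x] picked first only
    witnesses that the maximum is taken over a nonempty set. *)
Definition cell_of s C i : {set V} * {set I} :=
  if [pick x in above i s C] is Some x
  then ([arg max_(y > x in above i s C) r i y] |: s, C)
  else (s, C :\ i).

Definition is_cell (a : {set V} * {set I}) :=
  (#|a.1| == #|a.2|) && dominant a.1 a.2.

Definition is_door (a : {set V} * {set I}) :=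
  (#|a.2| == #|a.1|.+1) && dominant a.1 a.2.

Definition incident (d a : {set V} * {set I}) :=
  (d.1 \subset a.1) && (a.2 \subset d.2).

Lemma aboveP i x s C :
  reflect (forall l, l \in C -> l != i -> ~~ below l x s) (x \in above i s C).
Proof.
apply: (iffP 'forall_implyP) => H l.
  by move=> lC li; apply: H; rewrite !inE li.
by rewrite !inE => /andP[li lC]; exact: H.
Qed.

Lemma cell_ofP s C i : i \in redundant s C -> is_door (s, C) ->
  is_cell (cell_of s C i) && incident (s, C) (cell_of s C i).
Proof.
rewrite inE => /andP[iC /attainsP red] /andP[/= /eqP card_C /dominantP dom].
rewrite /cell_of /is_cell /incident; case: pickP => [x0 x0Q|Q0] /=.
  case: arg_maxnP => //= x xQ xmax.
  have xs : x \notin s.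
    apply/negP => /red[l]; rewrite !inE => /andP[li lC].
    by apply/negP; move/aboveP: xQ; exact.
  rewrite cardsU1 xs card_C add1n eqxx subsetUr subxx !andbT /=.
  apply/dominantP => y; have [yQ|] := boolP (y \in above i s C).
    have [l lC yl] := dom y.
    have li : l = i by apply/eqP/negPn/negP => /(aboveP _ _ _ _ yQ l lC); rewrite yl.
    exists l => //; apply/belowP => z; rewrite !inE => /predU1P[->|zs].
      by rewrite li; exact: xmax.
    by move/belowP: yl; exact.
  rewrite inE negb_forall_in => /exists_inP[l]; rewrite !inE negbK => /andP[li lC] yl.
  exists l => //; apply/belowP => z.
  rewrite !inE => /predU1P[->|]; last by move/belowP: yl; exact.
  have := aboveP _ _ _ _ xQ l lC li.
  rewrite negb_forall_in => /exists_inP[z' z's]; rewrite -ltnNge => /ltnW; apply: leq_trans.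
  by move/belowP: yl; exact.
rewrite subxx subsetDl !andbT.
have := cardsD1 i C; rewrite iC card_C add1n => -[<-]; rewrite eqxx /=.
apply/dominantP => y; have := Q0 y.
move/negbT; rewrite negb_forall_in => /exists_inP[l lC]; rewrite negbK => yl.
by exists l.
Qed.

(** When a point [x] was added, the index at which [x] is minimal is the exit:
    if [x] were minimal at two indices, the remaining [#|s| - 1] indices would
    have to reach all of [s]. *)
Lemma incident_cell s C (a : {set V} * {set I}) :
  is_door (s, C) -> is_cell a -> incident (s, C) a ->
  exists2 i, i \in redundant s C & a = cell_of s C i.
Proof.
case: a => t D /andP[/= /eqP cC domC] /andP[/= /eqP cD dom] /andP[/= st DC].
have {}domC := domC.
have [Et|neq_st] := eqVneq s t.
  (* the index is dropped *)
  subst t.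
  have [i iC ED] : exists2 i, i \in C & D = C :\ i.
    have : #|C :\: D| = 1 by rewrite cardsD (setIidPr DC) cC cD subSnn.
    move/eqP/cards1P => [i Ei]; exists i.
      have : i \in C :\: D by rewrite Ei set11.
      by rewrite inE => /andP[].
    apply/setP => l; have := congr1 (fun A : {set I} => l \in A) Ei.
    rewrite !inE; have := subsetP DC l; case: (l \in D) => /=.
      by move=> -> // <-.
    by move=> _ ->; case: (l == i).
  subst D; exists i; first by rewrite inE iC; exact: dominant_attains.
  rewrite /cell_of; case: pickP => // x /aboveP xQ.
  have [l] := dominantP _ _ dom x; rewrite !inE => /andP[li lC].
  by apply: contraTeq => _; exact: xQ.
have ltst : #|s| < #|t|.
  rewrite ltn_neqAle subset_leq_card// andbT; apply: contra neq_st => /eqP e.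
  by rewrite eqEcard st e leqnn.
have ED : D = C.
  by apply/eqP; rewrite eqEcard DC cC -cD.
subst D.
have [x xs Et] : exists2 x, x \notin s & t = x |: s.
  have : #|t :\: s| = 1 by rewrite cardsD (setIidPr st) cD cC subSnn.
  move/eqP/cards1P => [x Ex]; exists x.
    have : x \in t :\: s by rewrite Ex set11.
    by rewrite inE => /andP[].
  by rewrite -(setID t s) (setIidPr st) Ex setUC.
subst t.
have xt : x \in x |: s by rewrite !inE eqxx.
have [i iC xi] := dominantP _ _ dom x.
have iR : i \in redundant s C.
  rewrite inE iC; apply/attainsP => z zs.
  have [l lC zl] := dominantP _ _ dom z.
  exists l; last by apply: below_sub zl; exact: subsetUr.
  rewrite !inE lC andbT; apply: contraNneq xs => li; subst l.
  by rewrite (below_uniq xt _ xi zl) // !inE zs orbT.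
exists i => //.
have xQ : x \in above i s C.
  apply/aboveP => l lC li; apply/negP => xl.
  have xl' : below l x (x |: s).
    by apply/belowP => z; rewrite !inE => /predU1P[->//|]; move/belowP: xl; exact.
  have : attains s (C :\ i :\ l).
    apply/attainsP => z zs.
    have zt : z \in x |: s by rewrite !inE zs orbT.
    have [j jC zj] := dominantP _ _ dom z.
    have neq_j h : below h x (x |: s) -> j != h.
      move=> xh; apply: contraNneq xs => jh; subst h.
      by rewrite (below_uniq xt zt xh zj).
    exists j; first by rewrite !inE jC !neq_j.
    by apply: below_sub zj; exact: subsetUr.
  move/attains_leq_card.
  have := cardsD1 l (C :\ i); rewrite !inE li lC /=.
  have := cardsD1 i C; rewrite iC cC => -[->] ->.
  by rewrite add1n ltnn.
rewrite /cell_of; case: pickP => [x0 x0Q|/(_ x)]; last by rewrite xQ.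
case: arg_maxnP => //= x' x'Q x'max.
suff -> : x' = x by [].
apply: (@r_inj i); apply/eqP; rewrite eqn_leq x'max // andbT.
have [l lC] := dominantP _ _ dom x'.
have [-> /belowP/(_ _ xt)//|li] := eqVneq l i.
move/(below_sub (subsetUr [set x] s)) => x'l.
by have := aboveP _ _ _ _ x'Q l lC li; rewrite x'l.
Qed.

(** A point added through two different exits would lie above the minimum of
    [s] in every index of [C], against dominance. *)
Lemma cell_of_inj s C : is_door (s, C) -> {in redundant s C &, injective (cell_of s C)}.
Proof.
move=> dr i j iR jR; have := cell_ofP iR dr; move: iR jR.
rewrite !inE => /andP[iC _] /andP[jC _].
rewrite /cell_of; case: pickP => [x0 x0Q|_]; case: pickP => [y0 y0Q|_].
- case: arg_maxnP => //= x xQ _; case: arg_maxnP => //= y yQ _.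
  move=> /andP[/andP[/= /eqP cC dom] _] [E]; apply/eqP/negPn/negP => ij.
  have xs : x \notin s.
    move/eqP: cC; case/andP: dr => /= /eqP -> _.
    by rewrite cardsU1; case: (x \in s) => //; rewrite add0n => /eqP/n_Sn.
  have xy : x = y.
    have : x \in y |: s by rewrite -E !inE eqxx.
    by rewrite !inE (negPf xs) orbF => /eqP.
  subst y; have [l lC xl] := dominantP _ _ (proj2 (andP dr)) x.
  have [li|li] := eqVneq l i.
    by have := aboveP _ _ _ _ yQ l lC; rewrite li ij -li xl => /(_ isT).
  by have := aboveP _ _ _ _ xQ l lC li; rewrite xl.
- move=> _ [_ /setP/(_ j)]; by rewrite !inE eqxx jC.
- move=> _ [_ /setP/(_ i)]; by rewrite !inE eqxx iC.
- move=> _ [/setP/(_ i)]; rewrite !inE eqxx iC /= andbT => /esym/negbFE/eqP//.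
Qed.

(** The map sending an index to the minimal point of [s] goes from [C] onto [s],
    which has one element fewer: exactly two indices share their value, and
    these are the exits. For [s = set0] there is a single index. *)
Lemma card_redundant s C : is_door (s, C) ->
  #|redundant s C| = if s == set0 then 1 else 2.
Proof.
move=> /andP[/= /eqP cC dom].
have [s0|/set0Pn[z0 z0s]] := eqVneq s set0.
  suff -> : redundant s C = C by rewrite cC s0 cards0.
  apply/setP => i; rewrite inE; case: (i \in C) => //=.
  by apply/attainsP => z; rewrite s0 inE.
pose m i := [arg min_(z < z0 in s) r i z].
have mP i : m i \in s /\ below i (m i) s.
  by rewrite /m; case: arg_minnP => // z zs zm; split => //; apply/belowP.
have mE i z : z \in s -> below i z s -> m i = z.
  by move=> zs zi; have [h1 h2] := mP i; exact: (below_uniq h1 zs h2 zi).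
have [i [j [iC jC ij mij]]] : exists i j, [/\ i \in C, j \in C, i != j & m i = m j].
  have : ~~ [forall i in C, forall j in C, (m i == m j) ==> (i == j)].
    apply/negP => H; have : {in C &, injective m}.
      move=> i j iC jC /eqP mij; apply/eqP; move: H.
      move=> /forall_inP/(_ i iC)/forall_inP/(_ j jC).
      by rewrite mij.
    move/card_in_imset => e; have : #|m @: C| <= #|s|.
      by apply/subset_leq_card/subsetP => z /imsetP[i _ ->]; case: (mP i).
    by rewrite e cC ltnn.
  rewrite negb_forall_in => /exists_inP[i iC]; rewrite negb_forall_in => /exists_inP[j jC].
  by rewrite negb_imply => /andP[/eqP mij ij]; exists i, j.
suff -> : redundant s C = [set i; j] by rewrite cards2 ij.
have red i' j' : i' \in C -> j' \in C -> i' != j' -> m i' = m j' -> attains s (C :\ i').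
  move=> i'C j'C ij' mij'; apply/attainsP => z zs.
  have [l lC zl] := dominantP _ _ dom z.
  have [li|li] := eqVneq l i'; last by exists l => //; rewrite !inE li.
  exists j'; first by rewrite !inE j'C eq_sym ij'.
  rewrite -(mE _ _ zs zl) li mij'; by case: (mP j').
apply/setP => l; rewrite !inE; apply/andP/orP => [[lC att]|[]/eqP ->]; last 2 first.
- by split=> //; exact: (red i j).
- by split=> //; apply: (red j i) => //; rewrite eq_sym.
apply/orP; apply: contraTT att; rewrite negb_or => /andP[li lj].
apply/negP => /attainsP att.
have : attains s (C :\ l :\ i).
  apply/attainsP => z zs; have [h] := att z zs.
  rewrite !inE => /andP[hl hC] zh.
  have [hi|hi] := eqVneq h i; last by exists h => //; rewrite !inE hi hl.
  exists j; first by rewrite !inE jC (eq_sym j) ij eq_sym lj.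
  rewrite -(mE _ _ zs zh) hi mij; by case: (mP j).
move/attains_leq_card; have := cardsD1 i (C :\ l); rewrite !inE eq_sym li iC /=.
have := cardsD1 l C; rewrite lC cC => -[->] ->.
by rewrite add1n ltnn.
Qed.

Lemma card_cells s C : is_door (s, C) ->
  #|[set a | is_cell a & incident (s, C) a]| = if s == set0 then 1 else 2.
Proof.
move=> dr; rewrite -(card_redundant dr) -(card_in_imset (cell_of_inj dr)).
congr #|pred_of_set _|; apply/setP => a; rewrite inE; apply/andP/imsetP.
  by move=> [ca ia]; exact: incident_cell.
by move=> [i iR ->]; apply/andP; exact: cell_ofP.
Qed.


Variables (c : V -> I) (i0 : I).

Definition fully_labelled (a : {set V} * {set I}) := a.2 == i0 |: c @: a.1.

Lemma door_label_inj s : #|i0 |: c @: s| = #|s|.+1 ->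
  {in s &, injective c} /\ i0 \notin c @: s.
Proof.
move=> cC; have le := leq_imset_card c s.
have ni0 : i0 \notin c @: s.
  by apply: contraTN le => i0s; rewrite -ltnNge -cC cardsU1 i0s add0n.
split=> //; apply/imset_injP/eqP.
by move: cC; rewrite cardsU1 ni0 add1n => -[].
Qed.

Definition proper_door t D s :=
  [&& s \subset t, D \subset i0 |: c @: s & #|i0 |: c @: s| == #|s|.+1].

Lemma doors_of_cellE t D : is_cell (t, D) ->
  #|[set d | [&& is_door d, fully_labelled d & incident d (t, D)]]| =
  #|[set s | proper_door t D s]|.
Proof.
move=> /andP[/= /eqP ct dom].
rewrite -(@card_imset _ _ (fun s => (s, i0 |: c @: s))); last by move=> x y [].
congr #|pred_of_set _|; apply/setP => -[s C]; rewrite inE; apply/idP/imsetP.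
  move=> /and3P[/andP[/= cC ds]] /eqP/= EC /andP[/= st DC]; subst C.
  by exists s => //; rewrite inE /proper_door st DC.
move=> [s']; rewrite inE => /and3P[st DC cC] [-> ->].
rewrite /is_door /fully_labelled /incident /= cC eqxx st DC !andbT /=.
exact: dominant_sub dom.
Qed.

(** If there is a door, there are two. When [i0] and the labels of [t] make up
    [D] and one further label [c x], these are [t] and [t :\ x]. Otherwise they
    make up [D], two points of [t] share a label, and the doors are obtained by
    removing either of them. *)
Lemma doors_of_cell t D : is_cell (t, D) -> c @: t != D ->
  ~~ odd #|[set d | [&& is_door d, fully_labelled d & incident d (t, D)]]|.
Proof.
move=> cell; rewrite doors_of_cellE //; case/andP: cell => /= /eqP ct _ ctD.
(* a proper door is t itself, or t minus one point *)
have doorD1 s : proper_door t D s -> s != t ->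
    exists2 x, x \in t & s = t :\ x /\ D = i0 |: c @: s.
  move=> /and3P[st DC /eqP cC] nst.
  have ltst : #|s| < #|t|.
    rewrite ltn_neqAle subset_leq_card// andbT; apply: contra nst => /eqP e.
    by rewrite eqEcard st e leqnn.
  have ED : D = i0 |: c @: s by apply/eqP; rewrite eqEcard DC cC -ct.
  have : #|t :\: s| = 1 by rewrite cardsD (setIidPr st) ct ED cC subSnn.
  move/eqP/cards1P => [x Ex]; exists x.
    have : x \in t :\: s by rewrite Ex set11.
    by rewrite inE => /andP[].
  by split=> //; rewrite -Ex setDDr setDv set0U (setIidPr st).
have doorD1P x : x \in t -> D = i0 |: c @: (t :\ x) -> proper_door t D (t :\ x).
  move=> xt ED; rewrite /proper_door -ED subxx subD1set /= -ct.
  by rewrite (cardsD1 x t) xt.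
have [dt|ndt] := boolP (proper_door t D t).
  case/and3P: dt => _ DU /eqP cU; have [cinj i0t] := door_label_inj cU.
  have : #|(i0 |: c @: t) :\: D| = 1.
    by rewrite cardsD (setIidPr DU) cU ct subSnn.
  move/eqP/cards1P => [p Ep].
  have ED : D = (i0 |: c @: t) :\ p.
    by rewrite -Ep setDDr setDv set0U (setIidPr DU).
  have pU : p \in (i0 |: c @: t) :\: D by rewrite Ep set11.
  have pi0 : p != i0.
    apply: contraNneq ctD => E; rewrite ED E; apply/eqP/setP => i.
    by rewrite !inE; case: eqVneq => [->|//]; rewrite (negPf i0t).
  move: pU; rewrite !inE (negPf pi0) /= => /andP[_ /imsetP[x xt Epx]].
  have EDx : D = i0 |: c @: (t :\ x).
    rewrite ED; apply/setP => i; rewrite !inE.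
    have [-> /=|ip /=] := eqVneq i p.
      rewrite (negPf pi0) /=; apply/esym/negbTE/imsetP => -[y].
      rewrite !inE => /andP[yx yt] E; move: yx; rewrite (cinj y x) ?eqxx//.
      by rewrite -E.
    congr orb; apply/imsetP/imsetP => -[y yt E]; exists y => //.
      by rewrite !inE yt andbT; apply: contraNneq ip => yx; rewrite E yx Epx.
    by move: yt; rewrite !inE => /andP[].
  suff -> : [set s | proper_door t D s] = [set t; t :\ x].
    rewrite cards2; case: eqVneq => [/setP/(_ x)|//].
    by rewrite !inE xt eqxx.
  apply/setP => s; rewrite !inE; apply/idP/orP; last first.
    move=> [] /eqP ->; last exact: doorD1P.
    by rewrite /proper_door subxx DU cU eqxx.
  move=> ds; have [|nst] := eqVneq s t; [by left|right].
  have [y yt [Es EDy]] := doorD1 s ds nst.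
  rewrite Es; apply/eqP; congr (t :\ _); apply/eqP/negPn/negP => yx.
  have : p \in D.
    by rewrite EDy inE Es Epx imset_f ?orbT// !inE xt andbT eq_sym.
  by rewrite ED !inE eqxx.
have [->|/set0Pn[s]] := eqVneq [set s | proper_door t D s] set0; first by rewrite cards0.
rewrite inE => ds.
have nst : s != t by apply: contraNneq ndt => E; rewrite -{2}E.
have [x xt [Es ED]] := doorD1 s ds nst.
case/and3P: ds => _ _ /eqP cs; have [cinj i0s] := door_label_inj cs.
have cxD : c x \in D.
  apply: contraNT ndt => cxD.
  have Et : i0 |: c @: t = c x |: D.
    by rewrite ED Es setUCA -imsetU1 (setD1K xt).
  by rewrite /proper_door subxx Et subsetUr cardsU1 cxD -ct eqxx.
have cxi0 : c x != i0.
  by apply: contraNneq ctD => E; rewrite ED Es -E -imsetU1 (setD1K xt).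
have [x' x's Ecx] : exists2 x', x' \in s & c x = c x'.
  by apply/imsetP; move: cxD; rewrite ED !inE (negPf cxi0).
have x't : x' \in t by move: x's; rewrite Es !inE => /andP[].
have xx' : x != x' by move: x's; rewrite Es !inE eq_sym => /andP[].
have EDx' : D = i0 |: c @: (t :\ x').
  rewrite ED Es; congr (_ |: _); apply/setP => i; apply/imsetP/imsetP => -[y].
    rewrite !inE => /andP[yx yt] ->.
    have [->|yx'] := eqVneq y x'; last by exists y; rewrite // !inE yx'.
    by exists x; rewrite // !inE xt xx'.
  rewrite !inE => /andP[yx' yt] ->.
  have [->|yx] := eqVneq y x; last by exists y; rewrite // !inE yx.
  by exists x'; rewrite // !inE x't eq_sym xx'.
suff -> : [set s | proper_door t D s] = [set t :\ x; t :\ x'].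
  rewrite cards2; case: eqVneq => [/setP/(_ x)|//].
  by rewrite !inE xt eqxx xx'.
apply/setP => s'; rewrite !inE; apply/idP/orP => [ds'|[] /eqP ->]; last 2 first.
- by apply: doorD1P => //; rewrite ED Es.
- exact: doorD1P.
have nst' : s' != t by apply: contraNneq ndt => E; rewrite -{2}E.
have [y yt [Es' EDy]] := doorD1 s' ds' nst'.
have [yx|yx] := eqVneq y x; first by left; rewrite Es' yx.
have [yx'|yx'] := eqVneq y x'; first by right; rewrite Es' yx'.
have ys : y \in s by rewrite Es !inE yx.
have : c y \in i0 |: c @: s' by rewrite -EDy ED !inE imset_f ?orbT.
rewrite !inE; case: eqVneq => [E _|_ /= /imsetP[z]].
  by move: i0s; rewrite -E imset_f.
rewrite Es' !inE => /andP[zy zt] E.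
have [zx|zx] := eqVneq z x.
  by move: yx'; rewrite (cinj y x') ?eqxx// E zx.
by move: zy; rewrite (cinj y z) ?eqxx// Es !inE zx.
Qed.

(** A double count of the pairs formed by a door and a cell bordering it. The
    door [(set0, [set i0])] borders one cell and every other door two, so that
    the number of pairs is odd; hence some cell has an odd number of doors, and
    by [doors_of_cell] its labels are the right ones. *)
Theorem scarf : exists2 s, s != set0 & dominant s (c @: s).
Proof.
have [/existsP[[s C] /= /andP[/andP[/= _ dom]] /eqP E]|] :=
    boolP [exists a : {set V} * {set I}, is_cell a && (c @: a.1 == a.2)].
  rewrite -E in dom; exists s => //.
  by move: (dominant_neq0 dom); rewrite imset_eq0.
rewrite negb_exists => /forallP nogood.
pose doors := [set d | is_door d && fully_labelled d].
pose cells := [set a | is_cell a].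
have : \sum_(d in doors) #|[set a | is_cell a & incident d a]| =
       \sum_(a in cells) #|[set d | [&& is_door d, fully_labelled d & incident d a]]|.
  transitivity (\sum_(d in doors) \sum_(a in cells) (incident d a : nat)).
    apply: eq_bigr => d _; rewrite -sum1_card big_mkcond [RHS]big_mkcond.
    by apply: eq_bigr => a _; rewrite !inE; case: is_cell; case: incident.
  rewrite exchange_big; apply: eq_bigr => a _.
  rewrite -sum1_card big_mkcond [RHS]big_mkcond; apply: eq_bigr => d _.
  by rewrite !inE; case: is_door; case: fully_labelled; case: incident.
move/(congr1 odd); rewrite (bigD1 (set0, [set i0])) /=; last first.
  rewrite inE /is_door /fully_labelled /= imset0 setU0 eqxx cards1 cards0 eqxx.
  rewrite !andbT; apply/dominantP => y; exists i0; first exact: set11.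
  by apply/belowP => z; rewrite inE.
rewrite card_cells; last first.
  rewrite /is_door /= cards1 cards0 eqxx; apply/dominantP => y.
  by exists i0; [exact: set11|apply/belowP => z; rewrite inE].
rewrite eqxx oddD /=.
rewrite (_ : odd (\sum_(i in _ | _) _) = false); last first.
  apply: (big_ind (fun n => odd n = false)) => [//|x y|[s C]]; first by rewrite oddD => -> ->.
  rewrite !inE => /andP[/andP[dr /eqP/= EC] n0]; rewrite card_cells //.
  case: eqVneq => // s0; case/eqP: n0; rewrite EC s0.
  by rewrite imset0 setU0.
rewrite (_ : odd _ = false) //; apply: (big_ind (fun n => odd n = false)) => [//|x y|[t D]].
  by rewrite oddD => -> ->.
rewrite inE => cell; apply/negbTE/doors_of_cell => //.
by move: (nogood (t, D)); rewrite cell.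
Qed.

End Scarf.

(** * Labellings of a grid on the simplex *)

Section Grid.
Import ssrnat fintype boot.finset.
Variables n m : nat.
Notation grid := {ffun 'I_n -> 'I_m.+1}.

(** The points of [s] agree up to [n] steps of the grid, and up to [n] steps they
    lie on the face spanned by their own labels: this is what a completely
    labelled cell of a fine triangulation gives. It is [scarf] for the orders by
    coordinate. Dominance forces the minima [mu i] over [i] in [C] to add up to
    more than [m - n], for otherwise the grid point with coordinates above every
    [mu i] would contradict it; since the coordinates of a point add up to [m],
    little is left for it to exceed the minima. *)
Lemma simplex_labels (c : grid -> 'I_n) : 0 < n ->
  exists s : {set grid},
   [/\ s != set0,
       {in s, forall x : grid, \sum_i (x i : nat) = m},
       {in s &, forall (x x' : grid) i, x i <= x' i + n}
     & {in s, forall (x : grid) i, i \notin c @: s -> x i <= n}].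
Proof.
move=> n0; pose i0 : 'I_n := Ordinal n0.
pose V := {x : grid | \sum_i (x i : nat) == m}.
(* the coordinate, with ties broken by the position in the enumeration *)
pose r (i : 'I_n) (x : V) := val x i * #|{: V}| + enum_rank x.
have r_inj i : injective (r i).
  move=> x y; rewrite /r => /(congr1 (modn^~ #|{: V}|)).
  by rewrite !modnMDl !modn_small// => /ord_inj/enum_rank_inj.
have r_le i x y : r i x <= r i y -> val x i <= val y i.
  rewrite /r; apply: contraTT; rewrite -!ltnNge => lt.
  have := ltn_ord (enum_rank y); set B := #|_| => ltB.
  apply: (@leq_trans (val y i * B + B)); first by rewrite ltn_add2l.
  by rewrite -mulSnr; apply: leq_trans (leq_addr _ _); rewrite leq_mul2r lt orbT.
have [x0 x0P] : {x : V | val x = [ffun i => if i == i0 then ord_max else ord0]}.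
  apply: (exist _ (Sub _ _)); last by move=> H; rewrite SubK.
  apply/eqP; rewrite (bigD1 i0)//= big1 ?ffunE ?eqxx ?addn0//.
  by move=> i; rewrite ffunE => /negPf ->.
have [s s0 /dominantP dom] := scarf r_inj x0 (fun x => c (val x)) i0.
have [z0 z0s] : exists z, z \in s by apply/set0Pn.
set C := _ @: s in dom.
pose mu i := val [arg min_(z < z0 in s) (val z i : nat)] i : nat.
have muP i : (exists2 z, z \in s & mu i = val z i) /\ {in s, forall z : V, mu i <= val z i}.
  by rewrite /mu; case: arg_minnP => // z zs zm; split=> //; exists z.
have sumV (x : V) : \sum_i (val x i : nat) = m by apply/eqP/(valP x).
have sumC (x : V) : \sum_(i in C) (val x i : nat) <= m.
  rewrite -[leqRHS](sumV x) [leqRHS](bigID (mem C))/=; exact: leq_addr.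
have large : m < \sum_(i in C) (mu i).+1.
  rewrite ltnNge; apply/negP => le_m.
  have [j jC] : exists j, j \in C by exists (c (val z0)); apply/imsetP; exists z0.
  pose rest := \sum_(i in C | i != j) (mu i).+1.
  have rest_le : (mu j).+1 + rest <= m by rewrite -(bigD1 j).
  have mu_le i : mu i < m.+1.
    have [[z _ ->] _] := muP i; exact: ltn_ord.
  (* all that remains of the total m goes to the coordinate j *)
  pose y : grid := [ffun i => if i == j then inord (m - rest)
                              else if i \in C then inord (mu i).+1 else ord0].
  have yj : y j = m - rest :> nat by rewrite ffunE eqxx inordK// ltnS leq_subr.
  have yC i : i \in C -> i != j -> y i = (mu i).+1 :> nat.
    move=> iC ij; rewrite ffunE (negPf ij) iC inordK// ltnS.
    by apply: leq_trans le_m; rewrite (bigD1 i)//= leq_addr.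
  have yP : \sum_i (y i : nat) == m.
    rewrite (bigID (mem C))/= [X in _ + X]big1 ?addn0; last first.
      move=> i iC; rewrite ffunE (negPf iC); case: eqVneq => // ij.
      by move: iC; rewrite ij jC.
    rewrite (bigD1 j)//= yj (eq_bigr (fun i => (mu i).+1)).
      by rewrite -/rest subnK//; apply: leq_trans rest_le; exact: leq_addl.
    by move=> i /andP[]; exact: yC.
  have [i iC /belowP yi] := dom (Sub y yP : V).
  have [[z zs Ez] _] := muP i.
  have := r_le _ _ _ (yi z zs); rewrite -Ez SubK; apply/negP; rewrite -ltnNge.
  have [->|ij] := eqVneq i j; last by rewrite yC.
  by rewrite yj ltn_subRL addnC.
have cardC : #|C| <= n by rewrite -[leqRHS]card_ord max_card.
have largeD : m < \sum_(i in C) mu i + n.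
  apply: leq_trans large _.
  rewrite (eq_bigr (fun i => mu i + 1)); last by move=> i _; rewrite addn1.
  by rewrite big_split/= sum1_card leq_add2l.
have close (x : V) i : x \in s -> val x i <= mu i + n.
  move=> xs; have [iC|iC] := boolP (i \in C).
    have := leq_ltn_trans (sumC x) largeD.
    rewrite (bigD1 i)//= [X in _ < X + n](bigD1 i)//= -addnA (addnC _ n) addnA.
    have : \sum_(l in C | l != i) mu l <= \sum_(l in C | l != i) val x l.
      by apply: leq_sum => l _; have [_ ->] := muP l.
    set a := \sum_(_ in _ | _) _; set b := \sum_(_ in _ | _) _ => ab lt.
    rewrite -(leq_add2r b); apply: ltnW; apply: leq_trans lt _.
    by rewrite leq_add2l.
  have := ltnW largeD; rewrite -[X in X <= _](sumV x) [X in X <= _](bigID (mem C))/=.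
  have : \sum_(l in C) mu l <= \sum_(l in C) val x l.
    by apply: leq_sum => l _; have [_ ->] := muP l.
  move=> ab /leq_trans/(_ (leq_add ab (leqnn n))); rewrite leq_add2l.
  rewrite (bigD1 i)//= => /(leq_trans (leq_addr _ _))/leq_trans; apply.
  exact: leq_addl.
have small (x : V) i : x \in s -> i \notin C -> val x i <= n.
  move=> xs iC.
  have := ltnW largeD; rewrite -[X in X <= _](sumV x) [X in X <= _](bigID (mem C))/=.
  have : \sum_(l in C) mu l <= \sum_(l in C) val x l.
    by apply: leq_sum => l _; have [_ ->] := muP l.
  move=> ab /leq_trans/(_ (leq_add ab (leqnn n))); rewrite leq_add2l.
  by rewrite (bigD1 i)//= => /(leq_trans (leq_addr _ _)).
exists (val @: s); split.
- by rewrite imset_eq0.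
- by move=> _ /imsetP[x xs ->]; apply/eqP/(valP x).
- move=> _ _ /imsetP[x xs ->] /imsetP[x' x's ->] i.
  by apply: leq_trans (close x i xs) _; rewrite leq_add2r; have [_ ->] := muP i.
- move=> _ /imsetP[x xs ->] i; rewrite -imset_comp => iC; exact: small.
Qed.
End Grid.

Import Order.TTheory GRing.Theory Num.Theory numFieldNormedType.Exports.
Local Open Scope classical_set_scope.
Local Open Scope ring_scope.

(** * Convex sets and almost fixed points *)

Section Convex.
Context {R : realType} {X : normedModType R}.
Implicit Types (K : set X).

Definition convex K :=
  forall x y (s t : R), K x -> K y -> 0 <= s -> 0 <= t -> s + t = 1 ->
  K (s *: x + t *: y).

Lemma convex_scale (A : set X) (s : R) x : convex A -> A 0 -> A x -> 0 <= s <= 1 -> A (s *: x).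
Proof.
move=> cA A0 Ax /andP[s0 s1]; rewrite -[_ *: x]addr0 -(scaler0 _ (1 - s)).
by apply: cA => //; rewrite ?subr_ge0// addrC subrK.
Qed.

(** Written without division, so that the weights may vanish and the statement
    can be iterated. *)
Lemma convex_add K x y (s t : R) : convex K -> K x -> K y -> 0 <= s -> 0 <= t ->
  exists2 z, K z & s *: x + t *: y = (s + t) *: z.
Proof.
move=> cK Kx Ky s0 t0; have [st|st] := eqVneq (s + t) 0.
  exists x => //; rewrite st scale0r.
  have /andP[/eqP-> /eqP->] : (s == 0) && (t == 0) by rewrite -paddr_eq0// st.
  by rewrite !scale0r addr0.
exists ((s / (s + t)) *: x + (t / (s + t)) *: y).
  by apply: cK; rewrite ?divr_ge0 ?addr_ge0// -mulrDl divff.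
by rewrite scalerDr !scalerA mulrCA divff// mulr1 mulrCA divff// mulr1.
Qed.

Lemma convex_bigadd K (I : Type) (r : seq I) (P : pred I) (l : I -> R) (y : I -> X) :
  convex K -> K !=set0 -> (forall i, P i -> 0 <= l i) -> (forall i, P i -> K (y i)) ->
  exists2 z, K z & \sum_(i <- r | P i) l i *: y i = (\sum_(i <- r | P i) l i) *: z.
Proof.
move=> cK [x0 Kx0] l0 Ky.
suff [] : 0 <= \sum_(i <- r | P i) l i /\
    exists2 z, K z & \sum_(i <- r | P i) l i *: y i = (\sum_(i <- r | P i) l i) *: z by [].
apply: (big_ind2 (fun v s => 0 <= s /\ exists2 z, K z & v = s *: z)).
- by split=> //; exists x0 => //; rewrite scale0r.
- move=> _ s _ t [s0 [x Kx ->]] [t0 [z Kz ->]]; split; first exact: addr_ge0.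
  exact: convex_add.
- by move=> i Pi; split; [exact: l0|exists (y i) => //; exact: Ky].
Qed.

Lemma convex_sum K (I : finType) (P : pred I) (l : I -> R) (y : I -> X) :
  convex K -> (forall i, P i -> 0 <= l i) -> (forall i, P i -> K (y i)) ->
  \sum_(i | P i) l i = 1 -> K (\sum_(i | P i) l i *: y i).
Proof.
move=> cK l0 Ky l1.
have [j Pj] : exists j, P j.
  have [j Pj|P0] := pickP P; first by exists j.
  by move: l1; rewrite big_pred0// => /esym/eqP; rewrite oner_eq0.
have [|z Kz ->] := @convex_bigadd K I (index_enum I) P l y cK _ l0 Ky.
  by exists (y j); exact: Ky.
by rewrite l1 scale1r.
Qed.

(** Schauder's theorem for a totally bounded set, up to an error. Let the [y j]
    form a fine net of [K]. A grid point [l] of the simplex stands for the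
    barycentre [pt l] of the net, and is labelled by some [j] such that [y j] is
    close to [S (pt l)]. By [simplex_labels] there are grid points close to one
    another that carry all the labels of the face near which they lie. Uniform
    continuity then puts [S (pt l0)] close to every vertex [y j] of that face,
    hence close to the barycentre [pt l0] itself. *)
Lemma approximate_fixed_point K (S : X -> X) (M : R) :
  convex K -> K !=set0 -> (forall x, K x -> `|x| <= M) -> (forall x, K x -> K (S x)) ->
  (forall e, 0 < e -> exists n (y : 'I_n -> X), (forall i, K (y i)) /\
     forall x, K x -> exists i, `|x - y i| <= e) ->
  (forall e, 0 < e -> exists2 d, 0 < d & forall x y, K x -> K y -> `|x - y| <= d ->
     `|S x - S y| <= e) ->
  forall e, 0 < e -> exists2 x, K x & `|S x - x| <= e.
Proof.
move=> cK [x0 Kx0] KM SK net Suc e e0.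
have e4 : 0 < e / 4 by rewrite divr_gt0.
have [n [y [Ky cov]]] := net _ e4.
have [d d0 Sd] := Suc _ e4.
have M0 : 0 <= M by apply: le_trans (KM _ Kx0).
have [m [m0 md me]] : exists m, [/\ (0 < m)%N, n%:R * (n%:R / m%:R) * M <= d &
     n%:R * (n%:R / m%:R) * M <= e / 4].
  have min0 : 0 < Num.min d (e / 4) by rewrite lt_min d0.
  pose a := n%:R * n%:R * M / Num.min d (e / 4).
  have a0 : 0 <= a by rewrite divr_ge0 ?mulr_ge0// ltW.
  have lta := archi_boundP a0; exists (Num.bound a).
  have m0 : (0 < (Num.bound a)%:R :> R) by exact: le_lt_trans lta.
  have : n%:R * (n%:R / (Num.bound a)%:R) * M <= Num.min d (e / 4).
    rewrite mulrA mulrAC ler_pdivrMr// [leRHS]mulrC -ler_pdivrMr//; exact: ltW.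
  by rewrite le_min => /andP[h1 h2]; split=> //; rewrite -(ltr_nat R).
have mR : 0 < m%:R :> R by rewrite ltr0n.
pose pt (l : {ffun 'I_n -> 'I_m.+1}) : X := \sum_i ((l i : nat)%:R / m%:R) *: y i.
have i0 : 'I_n by have [i _] := cid (cov _ Kx0).
pose c l : 'I_n := odflt i0 [pick j | `|S (pt l) - y j| <= e / 4].
have [s [/set0Pn[l0 l0s] smP close small]] :=
  simplex_labels c (leq_ltn_trans (leq0n _) (ltn_ord i0)).
have sum1 (l : {ffun 'I_n -> 'I_m.+1}) : l \in s -> \sum_i ((l i : nat)%:R / m%:R) = 1 :> R.
  by move=> /smP E; rewrite -mulr_suml -natr_sum E divff// gt_eqF.
have Kpt l : l \in s -> K (pt l).
  by move=> ls; apply: convex_sum => //; exact: sum1.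
have cP l : l \in s -> `|S (pt l) - y (c l)| <= e / 4.
  move=> ls; rewrite /c; case: pickP => //= H.
  by have [j] := cov _ (SK _ (Kpt _ ls)); rewrite H.
have near_pt l : l \in s -> `|pt l0 - pt l| <= d.
  move=> ls; apply: le_trans md; rewrite /pt -sumrB.
  apply: (@le_trans _ _ (\sum_(i < n) n%:R / m%:R * M)); last first.
    by rewrite sumr_const card_ord -[leLHS]mulr_natl !mulrA.
  apply: le_trans (ler_norm_sum _ _ _) _; apply: ler_sum => i _.
  rewrite -scalerBl normrZ ler_pM//; last exact: KM.
  rewrite -mulrBl normrM normfV (gtr0_norm mR) ler_pM2r ?invr_gt0//.
  have := close _ _ ls l0s i; have := close _ _ l0s ls i.
  rewrite -!(ler_nat R) !natrD ler_norml => h1 h2.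
  by apply/andP; split; lra.
exists (pt l0); first exact: Kpt.
have far i : i \in [set c x | x in s]%SET -> `|S (pt l0) - y i| <= e / 4 + e / 4.
  move=> /imsetP[l ls ->]; apply: le_trans (ler_distD (S (pt l)) _ _) _.
  apply: lerD; last exact: cP.
  by apply: Sd; [exact: Kpt|exact: Kpt|exact: near_pt].
have -> : S (pt l0) - pt l0 = \sum_i ((l0 i : nat)%:R / m%:R) *: (S (pt l0) - y i).
  rewrite (eq_bigr _ (fun i _ => scalerBr _ _ _)) sumrB -scaler_suml.
  by rewrite sum1// scale1r.
apply: (@le_trans _ _ (\sum_i ((l0 i : nat)%:R / m%:R * (e / 4 + e / 4) +
    n%:R / m%:R * (M + M)))).
  apply: le_trans (ler_norm_sum _ _ _) _; apply: ler_sum => i _.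
  rewrite normrZ ger0_norm ?divr_ge0//.
  have h : 0 <= e / 4 + e / 4 by rewrite addr_ge0// ltW.
  have [iC|iC] := boolP (i \in [set c x | x in s]%SET).
    rewrite -[leLHS]addr0 lerD ?ler_wpM2l ?divr_ge0//; first exact: far.
    by rewrite mulr_ge0 ?divr_ge0 ?addr_ge0.
  rewrite -[leLHS]add0r lerD// ?mulr_ge0 ?divr_ge0//.
  rewrite ler_pM ?divr_ge0//.
    by rewrite ler_wpM2r ?invr_ge0// ler_nat; exact: small.
  by apply: le_trans (ler_normB _ _) _; apply: lerD; apply: KM => //; apply/SK/Kpt.
rewrite big_split/= -mulr_suml sum1// mul1r sumr_const card_ord -[X in _ + X]mulr_natl.
rewrite mulrDr mulrDr !mulrA; move: me; rewrite !mulrA.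
by set q := _ * M; lra.
Qed.

End Convex.

(** * Convex hulls and covers by sets of small diameter *)

Section Hulls.
Context {R : realType} {X : normedModType R}.
Implicit Types (A B K : set X) (d e : R).

Definition hull B : set X :=
  [set x | forall K, convex K -> B `<=` K -> K x].

Definition closed_hull B : set X :=
  [set x | forall K, closed K -> convex K -> B `<=` K -> K x].

Lemma sub_hull B : B `<=` hull B. Proof. by move=> x Bx K _; exact. Qed.

Lemma sub_closed_hull B : B `<=` closed_hull B.
Proof. by move=> x Bx K _ _; exact. Qed.

Lemma hull_min B K : convex K -> B `<=` K -> hull B `<=` K.
Proof. by move=> cK BK x; apply. Qed.

Lemma closed_hull_min B K : closed K -> convex K -> B `<=` K -> closed_hull B `<=` K.
Proof. by move=> clK cK BK x; apply. Qed.

Lemma hull_mono A B : A `<=` B -> hull A `<=` hull B.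
Proof. by move=> AB x Ax K cK /(subset_trans AB)/(Ax _ cK). Qed.

Lemma convex_hull B : convex (hull B).
Proof.
move=> x y s t Bx By s0 t0 st K cK BK.
exact: (cK _ _ _ _ (Bx _ cK BK) (By _ cK BK) s0 t0 st).
Qed.

Lemma convex_closed_hull B : convex (closed_hull B).
Proof.
move=> x y s t Bx By s0 t0 st K clK cK BK.
exact: (cK _ _ _ _ (Bx _ clK cK BK) (By _ clK cK BK) s0 t0 st).
Qed.

Lemma closed_closed_hull B : closed (closed_hull B).
Proof.
move=> x clx K clK cK BK; apply: (clK).
have sub : closed_hull B `<=` K by move=> y /(_ K clK cK BK).
exact: closure_subset sub _ clx.
Qed.

Lemma convex_ball_le (a : X) d : convex [set x | `|a - x| <= d].
Proof.
move=> x y s t /= ax ay s0 t0 st.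
have -> : a - (s *: x + t *: y) = s *: (a - x) + t *: (a - y).
  by rewrite !scalerBr addrACA -opprD -scalerDl st scale1r.
apply: le_trans (ler_normD _ _) _; rewrite !normrZ !ger0_norm//.
by rewrite -[leRHS]mul1r -st mulrDl lerD// ler_wpM2l.
Qed.

Lemma hull_diam B d : (forall x y, B x -> B y -> `|x - y| <= d) ->
  forall x y, hull B x -> hull B y -> `|x - y| <= d.
Proof.
move=> Bd x y hx hy; rewrite distrC.
apply: (hull_min (@convex_ball_le y d) _ hx) => a Ba /=; rewrite distrC.
apply: (hull_min (@convex_ball_le a d) _ hy) => b Bb /=; exact: Bd.
Qed.

Lemma hull_bounded B M : (forall x, B x -> `|x| <= M) ->
  forall x, hull B x -> `|x| <= M.
Proof.
move=> BM x hx; rewrite -normrN -sub0r.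
by apply: (hull_min (@convex_ball_le 0 M) _ hx) => y /BM; rewrite /= sub0r normrN.
Qed.

Lemma closureP A x :
  closure A x <-> forall e, 0 < e -> exists2 a, A a & `|x - a| <= e.
Proof.
split=> [cl e e0|H U /nbhs_ballP[e /= e0 xU]].
  have [y [Ay]] := cl _ (nbhsx_ballx x e e0).
  by rewrite -ball_normE /= => /ltW xy; exists y.
have [|a Aa xa] := H (e / 2); first by rewrite divr_gt0.
exists a; split=> //; apply: xU; rewrite -ball_normE /=.
by apply: le_lt_trans xa _; rewrite ltr_pdivrMr// ltr_pMr// ltr1n.
Qed.

Lemma convex_closure A : convex A -> convex (closure A).
Proof.
move=> cA x y s t /closureP clx /closureP cly s0 t0 st; apply/closureP => e e0.
have [a Aa xa] := clx e e0; have [b Ab yb] := cly e e0.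
exists (s *: a + t *: b); first exact: cA.
rewrite opprD addrACA -!scalerBr; apply: le_trans (ler_normD _ _) _.
rewrite !normrZ !ger0_norm// -[leRHS]mul1r -st mulrDl.
by rewrite lerD// ler_wpM2l.
Qed.

(** [kuratowski B] is the infimum of the [d > 0] with this property; see
    [kuratowski_le] and [covered_kuratowski]. *)
Definition covered d B := exists (I : finType) (C : I -> set X),
  (forall x, B x -> exists i, C i x) /\
  (forall i x y, C i x -> C i y -> `|x - y| <= d).

Lemma covered_sub d A B : A `<=` B -> covered d B -> covered d A.
Proof. by move=> AB [I [C [cB Cd]]]; exists I, C; split=> // x /AB/cB. Qed.

Lemma covered_le d d' B : d <= d' -> covered d B -> covered d' B.
Proof.
move=> dd' [I [C [cB Cd]]]; exists I, C; split=> // i x y Cx Cy.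
exact: le_trans (Cd i x y Cx Cy) dd'.
Qed.

Lemma covered_nonempty d B : covered d B ->
  exists (I : finType) (C : I -> set X),
  [/\ forall x, B x -> exists i, C i x, forall i, C i !=set0,
      forall i, C i `<=` B & forall i x y, C i x -> C i y -> `|x - y| <= d].
Proof.
move=> [I [C [cB Cd]]].
exists {i : I | `[< B `&` C i !=set0 >]}, (fun i => B `&` C (val i)); split.
- move=> x Bx; have [i Cx] := cB x Bx.
  have Pi : `[< B `&` C i !=set0 >] by apply/asboolP; exists x.
  by exists (exist _ i Pi).
- by move=> [i Pi]; exact/asboolP.
- by move=> i x [].
- by move=> i x y [_ Cx] [_ Cy]; exact: Cd Cx Cy.
Qed.

Lemma covered_setU1 d B a : 0 <= d -> covered d B -> covered d (a |` B).
Proof.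
move=> d0 [I [C [cB Cd]]].
exists (option I), (fun o => if o is Some i then C i else [set a]); split.
  by move=> x [->|/cB[i Cx]]; [exists None|exists (Some i)].
by move=> [i|] x y; [exact: Cd|move=> -> ->; rewrite subrr normr0].
Qed.

Lemma covered_lipschitz d k B (g : X -> X) : 0 <= k ->
  (forall x y, `|g x - g y| <= k * `|x - y|) ->
  covered d B -> covered (k * d) (g @` B).
Proof.
move=> k0 g_lip [I [C [cB Cd]]]; exists I, (fun i => g @` C i); split.
  by move=> _ [x /cB[i Cx] <-]; exists i, x.
move=> i _ _ [x Cx <-] [y Cy <-]; apply: le_trans (g_lip _ _) _.
by rewrite ler_wpM2l// (Cd i).
Qed.

Lemma covered_diff d B : covered d B ->
  covered (d + d) [set p.1 - p.2 | p in B `*` B].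
Proof.
move=> [I [C [cB Cd]]].
exists (I * I)%type, (fun i => [set p.1 - p.2 | p in C i.1 `*` C i.2]); split.
  move=> _ [[x y] [/= Bx By] <-]; have [i Cx] := cB x Bx; have [j Cy] := cB y By.
  by exists (i, j), (x, y).
move=> [i j] _ _ [[x y] [/= Cx Cy] <-] [[x' y'] [/= Cx' Cy'] <-].
rewrite opprB [y' - x']addrC addrACA [- y + y']addrC.
apply: le_trans (ler_normD _ _) _.
by apply: lerD; [exact: (Cd i)|exact: (Cd j)].
Qed.

(** Let the [C i] cover [B]. The closed hull is contained in the closure of the
    convex set [H] of the barycentres [\sum_i l i *: b i] with [b i] in the hull
    of [C i]. Barycentres whose weights agree up to [1 / m] differ by at most
    [d] plus a multiple of [1 / m], and up to that precision there are finitely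
    many weights; the cover is indexed by the integer parts of the [l i * m]. *)
Lemma covered_closed_hull d e M B : (forall x, B x -> `|x| <= M) ->
  B !=set0 -> 0 < e -> covered d B -> covered (d + e) (closed_hull B).
Proof.
move=> BM [x0 Bx0] e0 /covered_nonempty[I [C [cB C0 CB Cd]]].
pose H := [set z : X | exists (l : I -> R) (b : I -> X),
  [/\ forall i, 0 <= l i, \sum_i l i = 1, forall i, hull (C i) (b i) &
      z = \sum_i l i *: b i]].
have cvxH : convex H.
  move=> _ _ s t [l [b [l0 l1 Cb ->]]] [l' [b' [l0' l1' Cb' ->]]] s0 t0 st.
  have mix i : exists z, hull (C i) z /\
      (s * l i) *: b i + (t * l' i) *: b' i = (s * l i + t * l' i) *: z.
    have [z ? ?] := convex_add (@convex_hull (C i)) (Cb i) (Cb' i)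
      (mulr_ge0 s0 (l0 i)) (mulr_ge0 t0 (l0' i)).
    by exists z.
  have {mix}[b'' Cb''] := choice mix.
  exists (fun i => s * l i + t * l' i), b''; split.
  - by move=> i; rewrite addr_ge0 ?mulr_ge0.
  - by rewrite big_split/= -!mulr_sumr l1 l1' !mulr1.
  - by move=> i; case: (Cb'' i).
  - rewrite !scaler_sumr -big_split/=; apply: eq_bigr => i _.
    by rewrite !scalerA; case: (Cb'' i).
have BH : B `<=` H.
  move=> x Bx; have [i Cx] := cB x Bx.
  have [b0 Cb0] := choice C0.
  exists (fun j => (j == i)%:R), (fun j => if j == i then x else b0 j); split.
  - by move=> j; rewrite ler0n.
  - rewrite (bigD1 i)//= eqxx big1 ?addr0// => j /negPf->//.
  - by move=> j; apply: sub_hull; case: eqVneq => [->//|_]; exact: Cb0.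
  - rewrite (bigD1 i)//= eqxx scale1r big1 ?addr0// => j /negPf->.
    by rewrite scale0r.
have M0 : 0 <= M by apply: le_trans (BM _ Bx0).
have [m m0 me] : exists2 m, 0 < m%:R :> R & #|I|%:R * (m%:R^-1 * M) <= e / 2.
  pose a := #|I|%:R * M / (e / 2).
  have a0 : 0 <= a by rewrite divr_ge0 ?mulr_ge0 ?divr_ge0// ltW.
  have lta := archi_boundP a0; exists (Num.bound a); first exact: le_lt_trans lta.
  have m0 : 0 < (Num.bound a)%:R :> R by exact: le_lt_trans lta.
  rewrite mulrCA mulrC ler_pdivrMr// [leRHS]mulrC -ler_pdivrMr ?divr_gt0//.
  exact: ltW.
apply: (@covered_sub _ _ (closure H)).
  apply: closed_hull_min; [exact: closed_closure|exact: convex_closure|].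
  exact: subset_trans BH (@subset_closure _ _).
exists {ffun I -> 'I_m.+1}, (fun c : {ffun I -> 'I_m.+1} => [set x : X | exists2 z,
  `|x - z| <= e / 4 & exists (l : I -> R) (b : I -> X),
  [/\ forall i, 0 <= l i, \sum_i l i = 1, forall i, hull (C i) (b i),
      z = \sum_i l i *: b i & forall i, (c i)%:R <= l i * m%:R < (c i)%:R + 1]]).
split.
  move=> x /closureP/(_ (e / 4))[|z [l [b [l0 l1 Cb Ez]]] xz]; first by rewrite divr_gt0.
  exists [ffun i => inord (Num.truncn (l i * m%:R))], z => //.
  exists l, b; split=> // i; rewrite ffunE.
  have lm0 : 0 <= l i * m%:R by rewrite mulr_ge0// ltW.
  rewrite inordK; first by rewrite natr1; exact: truncn_itv.
  rewrite ltnS -(ler_nat R); have /andP[le _] := truncn_itv lm0.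
  apply: le_trans le _; rewrite ler_piMl ?(ltW m0)//.
  by rewrite -l1 (bigD1 i)//= lerDl sumr_ge0.
move=> c x x' [z xz [l [b [l0 l1 Cb Ez lc]]]] [z' xz' [l' [b' [l0' l1' Cb' Ez' lc']]]].
have zz' : `|z - z'| <= d + e / 2.
  have lP i : `|l i - l' i| <= m%:R^-1.
    rewrite -[leRHS]mul1r ler_pdivlMr// -[X in _ * X](gtr0_norm m0) -normrM mulrBl.
    have /andP[] := lc i; have /andP[] := lc' i.
    rewrite ler_norml => ? ? ? ?; apply/andP; split; lra.
  have -> : z - z' = \sum_i (l i *: (b i - b' i) + (l i - l' i) *: b' i).
    rewrite Ez Ez' -sumrB; apply: eq_bigr => i _.
    by rewrite scalerBr scalerBl addrA subrK.
  apply: le_trans (ler_norm_sum _ _ _) _.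
  apply: (@le_trans _ _ (\sum_i (l i * d + m%:R^-1 * M))).
    apply: ler_sum => i _; apply: le_trans (ler_normD _ _) _.
    rewrite !normrZ ger0_norm// lerD//.
      by rewrite ler_wpM2l//; exact: hull_diam (Cd i) _ _ _ _.
    by rewrite ler_pM//; apply: (hull_bounded _ (Cb' i)) => y /CB/BM.
  rewrite big_split/= -mulr_suml l1 mul1r sumr_const lerD2l.
  by rewrite -[leLHS]mulr_natl.
have : `|x - x'| <= `|x - z| + (`|z - z'| + `|x' - z'|).
  rewrite (le_trans (ler_distD z _ _))// lerD2l (le_trans (ler_distD z' _ _))//.
  by rewrite lerD2l distrC.
lra.
Qed.

End Hulls.

(** * The measure of noncompactness *)

Section Kuratowski.
Context {R : realType} {X : normedModType R}.
Implicit Types (B : set X) (d : R).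

Lemma diameter_leP (C : set X) d :
  (diameter C <= d%:E)%E <-> forall x y, C x -> C y -> `|x - y| <= d.
Proof.
split=> [le x y Cx Cy|H].
  rewrite -lee_fin; apply: le_trans le; apply: ereal_sup_ubound.
  by exists (x, y).
by apply: ge_ereal_sup => _ [[x y] [/= Cx Cy] <-]; rewrite lee_fin; exact: H.
Qed.

Lemma covers_has_lbound (P : R -> Prop) : has_lbound [set d | 0 < d /\ P d].
Proof. by exists 0 => d [/ltW]. Qed.

Lemma kuratowski_ge0 B : 0 <= kuratowski B.
Proof.
rewrite /kuratowski; set E := [set d | _].
have [->|E0] := eqVneq E set0; first by rewrite inf0.
by apply: lb_le_inf; [exact/set0P|move=> d [/ltW]].
Qed.

Lemma kuratowski_le B d : 0 < d -> covered d B -> kuratowski B <= d.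
Proof.
move=> d0 [I [C [cB Cd]]]; apply: ge_inf; first exact: covers_has_lbound.
split=> //; exists [set C i | i in [set: I]]; split.
- exact: finite_image.
- by move=> x /cB[i Cx]; exists (C i) => //; exists i.
- by move=> _ [i _ <-]; apply/diameter_leP; exact: Cd.
Qed.

Lemma covered_kuratowski B d M : (forall x, B x -> `|x| <= M) ->
  kuratowski B < d -> covered d B.
Proof.
move=> BM; rewrite /kuratowski; set E := [set d | _] => ltd.
have E0 : E !=set0.
  exists (`|M| + `|M| + 1); split; first by rewrite ltr_wpDl ?addr_ge0.
  exists [set B]; split; [exact: finite_set1|by move=> x Bx; exists B|].
  move=> _ ->; apply/diameter_leP => x y /BM xM /BM yM.
  apply: le_trans (ler_normB _ _) _; apply: ler_wpDr => //.
  by apply: lerD; apply: le_trans (ler_norm _).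
have /(inf_lt E0)[d' [_ [F [/finite_seqP[s Fs] BF Fd]]] d'd] := ltd.
exists 'I_(size s), (fun i : 'I_(size s) => nth set0 s i); split.
  move=> x /BF[C]; rewrite Fs => Cs Cx.
  have iP : (index C s < size s)%N by rewrite index_mem.
  by exists (Ordinal iP); rewrite /= nth_index.
move=> i x y Cx Cy; apply: le_trans (ltW d'd).
have : F (nth set0 s i) by rewrite Fs /=; apply: mem_nth; exact: ltn_ord.
by move/Fd/diameter_leP; apply.
Qed.

End Kuratowski.

(** * Compactness *)

Section Compactness.
Context {R : realType}.

Lemma ultra_finite_cover (T : Type) (F : set_system T) (I : finType) (C : I -> set T) :
  UltraFilter F -> F [set x | exists i, C i x] -> exists i, F (C i).
Proof.
move=> FU FC; apply/not_existsP => nC.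
have : F [set x | forall i, ~ C i x].
  by apply: filter_forall => i; case: (in_ultra_setVsetC (C i) FU) => // /nC.
by move/(filterI FC)/filter_ex => [x [[i Cx] /(_ i)]].
Qed.

(** Total boundedness makes every ultrafilter on [K] a Cauchy filter. *)
Lemma compact_covered (X : completeNormedModType R) (K : set X) :
  closed K -> (forall d, 0 < d -> covered d K) -> compact K.
Proof.
move=> clK covK; rewrite compact_ultra => F FU FK.
have Fc : cauchy F.
  apply: cauchy_exP => e e0.
  have [I [C [cC Cd]]] := covK _ (divr_gt0 e0 (ltr0Sn _ 1)).
  have [|i Fi] := @ultra_finite_cover _ F I C FU; first exact: filterS FK.
  have [x Cx] := filter_ex Fi; exists x; apply: filterS Fi => y Cy.
  rewrite -ball_normE /=; apply: le_lt_trans (Cd _ _ _ Cx Cy) _.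
  by rewrite ltr_pdivrMr// ltr_pMr// ltr1n.
have /cauchy_cvgP/cvg_ex[l Fl] := Fc.
exists l; split=> //; exact: (@closed_cvg _ _ F _ id K clK).
Qed.

Lemma covered_net (X : normedModType R) (K : set X) (e : R) : covered e K ->
  exists n (y : 'I_n -> X), (forall i, K (y i)) /\
    forall x, K x -> exists i, `|x - y i| <= e.
Proof.
move=> /covered_nonempty[I [C [cC C0 CK Cd]]]; have [y Cy] := choice C0.
exists #|I|, (fun i => y (enum_val i)); split=> [i|x /cC[i Cx]].
  by apply: CK; exact: Cy.
by exists (enum_rank i); rewrite enum_rankK; exact: (Cd i).
Qed.

Lemma uniform_continuity_compact (X : normedModType R) (K : set X) (S : X -> X) :
  compact K -> continuous S ->
  forall e, 0 < e -> exists2 d, 0 < d & forall x y, K x -> `|x - y| <= d ->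
     `|S x - S y| <= e.
Proof.
move=> cK cS e e0.
have e2 : 0 < e / 2 by rewrite divr_gt0.
have : \forall d \near 0^'+, forall x, K x -> forall y, `|x - y| <= d -> `|S x - S y| <= e.
  apply: (proj1 (compact_near_coveringP K) cK R (0^'+)
    (fun d x => forall y, `|x - y| <= d -> `|S x - S y| <= e)).
  move=> x Kx.
  have /cvgrPdist_le/(_ _ e2)/nbhs_ballP[d /= d0 dS] := cS x.
  have d2 : 0 < d / 2 by rewrite divr_gt0.
  exists (ball x (d / 2), [set r | r <= d / 2]).
    split; [exact: nbhsx_ballx|exact: nbhs_right_le].
  move=> [x' r] [/= xx' rd] y x'y.
  have h1 : `|S x - S x'| <= e / 2.
    by apply: dS; apply: le_ball xx'; lra.
  have h2 : `|S x - S y| <= e / 2.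
    apply: dS; move: xx'; rewrite -!ball_normE /= => xx'.
    by apply: le_lt_trans (ler_distD x' _ _) _; lra.
  apply: le_trans (ler_distD (S x) _ _) _; rewrite distrC; lra.
move=> nd.
have [d [/= d0 dP]] : exists d, 0 < d /\
    forall x, K x -> forall y, `|x - y| <= d -> `|S x - S y| <= e.
  by have [d] := filter_ex (filterI (nbhs_right_gt (0 : R)) nd); exists d.
by exists d => // x y Kx; exact: dP.
Qed.

Lemma ultra_limit (T : Type) (U : set_system T) (X : normedModType R) (K : set X)
  (x : T -> X) : UltraFilter U -> compact K -> (forall n, K (x n)) ->
  exists2 l, K l & x n @[n --> U] --> l.
Proof.
move=> UU cK Kx.
have UK : U (x @^-1` K) by apply: filterE => n; exact: Kx.
have [l [Kl cl]] := cK (x @ U) _ UK.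
exists l => // B Bl.
have [//|UB] := in_ultra_setVsetC (x @^-1` B) UU.
by have [y [nB By]] := cl (~` B) B UB Bl.
Qed.

End Compactness.

(** * The smallest stable closed convex set *)

Section Invariant.
Context {R : realType} {X : normedModType R}.

(** The intersection [K] of all closed convex sets that contain [0] and are
    stable under [Psi]. Requiring [0] keeps it nonempty. The closed hull of [0]
    and [Psi K] is stable as well because it is contained in [K], and thus
    minimality turns this inclusion into an equality. *)
Lemma minimal_invariant (Psi : set X -> set X) (M : R) :
  0 <= M ->
  (forall A B, A `<=` B -> Psi A `<=` Psi B) ->
  (forall A x, (forall y, A y -> `|y| <= M) -> Psi A x -> `|x| <= M) ->
  exists K : set X, [/\ closed K, convex K /\ K 0, Psi K `<=` K,
    K `<=` closed_hull (0 |` Psi K) & forall x, K x -> `|x| <= M].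
Proof.
move=> M0 mono bnd.
pose fam := [set C : set X | [/\ closed C, convex C, C 0 & Psi C `<=` C]].
pose K := \bigcap_(C in fam) C.
have KC C : fam C -> K `<=` C by move=> fC x; exact.
have famK : fam K.
  split.
  - by apply: closed_bigI => C [].
  - move=> x y s t Kx Ky s0 t0 st C fC; have [_ cC _ _] := fC.
    by apply: cC => //; [exact: Kx|exact: Ky].
  - by move=> C [].
  - move=> x Px C fC; have [_ _ _] := fC; apply; exact: mono (KC C fC) _ Px.
have [clK cK K0 PK] := famK.
pose D := [set x : X | `|0 - x| <= M].
have KM x : K x -> `|x| <= M.
  move=> Kx; rewrite -normrN -sub0r; apply: (KC D) Kx; split.
  - move=> y cly; rewrite /D /=; apply/ler_addgt0Pr => e e0.
    have /closureP/(_ e e0)[z Dz yz] := cly.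
    apply: le_trans (ler_distD z _ _) _; rewrite lerD//.
    by rewrite distrC.
  - exact: convex_ball_le.
  - by rewrite /D /= subrr normr0.
  - move=> y; rewrite /D /= sub0r normrN; apply: bnd => z.
    by rewrite /= sub0r normrN.
exists K; split=> //; apply: KC.
have hK : closed_hull (0 |` Psi K) `<=` K.
  by apply: closed_hull_min => // x [->|/PK].
split.
- exact: closed_closed_hull.
- exact: convex_closed_hull.
- by apply: sub_closed_hull; left.
- by move=> x /(mono _ _ hK) Px; apply: sub_closed_hull; right.
Qed.

End Invariant.

(** * Limits of polygons *)

Section PolygonLimit.
Context {R : realType} {X : normedModType R}.
Variable U : set_system nat.
Context {UP : ProperFilter U}.
Hypothesis U_oo : \oo `<=` U.

(** The polygons of index [n] have [n.+1] steps, while [node n t] is computed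
    with [n]: hence it is at most [n] even for [t = 1], and a step starts at
    every node in use. The price is an error of two steps in [node_close]. *)
Definition mesh (n : nat) : R := n.+1%:R^-1.
Definition node (n : nat) (t : R) : nat := Num.truncn (t * n%:R).

Lemma mesh_gt0 n : 0 < mesh n. Proof. by rewrite invr_gt0 ltr0n. Qed.

Lemma mesh_small e : 0 < e -> \forall n \near U, mesh n <= e.
Proof.
move=> e0; apply: U_oo; exists (Num.bound e^-1) => // n /= len.
rewrite /mesh -[leRHS]invrK lef_pV2 ?posrE ?invr_gt0 ?ltr0n//.
apply: ltW; apply: lt_le_trans (archi_boundP _) _; first by rewrite invr_ge0 ltW.
by rewrite ler_nat; exact: leq_trans len _.
Qed.

Lemma node_le n t : unit_interval R t -> (node n t <= n)%N.
Proof.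
rewrite /unit_interval/= in_itv/= => /andP[t0 t1]; rewrite -(ler_nat R).
have /andP[le _] := truncn_itv (mulr_ge0 t0 (ler0n R n)).
by apply: le_trans le _; rewrite ler_piMl.
Qed.

Lemma node_close n t : unit_interval R t -> `|(node n t)%:R * mesh n - t| <= mesh n *+ 2.
Proof.
move=> tI; have := tI; rewrite /unit_interval/= in_itv/= => /andP[t0 t1].
have /andP[le lt] := truncn_itv (mulr_ge0 t0 (ler0n R n)).
have n0 : 0 < n.+1%:R :> R by rewrite ltr0n.
have hN : mesh n * n.+1%:R = 1 by rewrite /mesh mulVf// gt_eqF.
rewrite -(ler_pM2r n0) -[X in _ * X <= _](gtr0_norm n0) -normrM mulrBl -mulrA hN.
rewrite mulr1 [leRHS]mulrnAl hN -natr1.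
rewrite -natr1 in lt; move: lt le; rewrite -/(node n t) ler_norml.
by move=> lt le; apply/andP; split; lra.
Qed.

Lemma node_itv n i : (i <= n.+1)%N -> 0 <= i%:R * mesh n <= 1.
Proof.
move=> i_n; rewrite mulr_ge0 ?(ltW (mesh_gt0 _))//=.
by rewrite /mesh ler_pdivrMr ?ltr0n// mul1r ler_nat.
Qed.

Lemma polygon_diff (z g : nat -> X) (h e : R) (l : X) i j :
  0 <= h -> (i <= j)%N ->
  (forall m, (i <= m < j)%N -> z m.+1 = z m + h *: g m /\ `|g m - l| <= e) ->
  `|z j - z i - ((j%:R - i%:R) * h) *: l| <= (j%:R - i%:R) * h * e.
Proof.
move=> h0; elim: j => [|j IH].
  by rewrite leqn0 => /eqP-> _; rewrite !subrr !mul0r scale0r subr0 normr0.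
rewrite leq_eqVlt => /predU1P[->|]; first by rewrite !subrr !mul0r scale0r subr0 normr0.
rewrite ltnS => ij H; have [|-> gl] := H j; first by rewrite ij ltnSn.
have {}IH := IH ij.
have -> : (j.+1%:R - i%:R) * h = (j%:R - i%:R) * h + h.
  by rewrite -natr1 addrAC mulrDl mul1r.
have -> : z j + h *: g j - z i - ((j%:R - i%:R) * h + h) *: l =
    (z j - z i - ((j%:R - i%:R) * h) *: l) + h *: (g j - l).
  by rewrite scalerDl scalerBr opprD (addrAC (z j)) addrACA.
apply: le_trans (ler_normD _ _) _; rewrite [leRHS]mulrDl; apply: lerD.
  by apply: IH => m /andP[im mj]; apply: H; rewrite im ltnW.
by rewrite normrZ ger0_norm// ler_wpM2l.
Qed.

(** The form in which the convergence of slopes is used: near [t], uniformly over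
    the nodes, but at a rate that may depend on [t]. *)
Definition locally_close (a : nat -> nat -> X) (l : R -> X) :=
  forall t e, unit_interval R t -> 0 < e -> exists2 d, 0 < d &
    \forall n \near U, forall i, (i <= n)%N -> `|i%:R * mesh n - t| <= d ->
      `|a n i - l t| <= e.

Lemma locally_close_lipschitz (a : nat -> nat -> X) (l : R -> X) (L : R) : 0 <= L ->
  (forall n i j, (i <= j <= n)%N -> `|a n j - a n i| <= L * (j%:R * mesh n - i%:R * mesh n)) ->
  (forall t, unit_interval R t -> a n (node n t) @[n --> U] --> l t) ->
  locally_close a l.
Proof.
move=> L0 lip lim t e tI e0.
have L1 : 0 < 8 * (L + 1) by rewrite mulr_gt0// ltr_wpDl.
pose d := e / (8 * (L + 1)).
have d0 : 0 < d by rewrite divr_gt0.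
exists d => //.
have e2 : 0 < e / 2 by rewrite divr_gt0.
have /cvgrPdist_le/(_ _ e2) limt := lim t tI.
near=> n => i ni it.
have lipn : forall j m, (j <= n)%N -> (m <= n)%N ->
    `|a n j - a n m| <= L * `|j%:R * mesh n - m%:R * mesh n|.
  move=> j m jn mn; have h0 := mesh_gt0 n; have [jm|/ltnW mj] := leqP j m.
    rewrite distrC (distrC (j%:R * _)) [X in L * X]ger0_norm; first by rewrite lip// jm.
    by rewrite subr_ge0 ler_pM2r// ler_nat.
  rewrite [X in L * X]ger0_norm; first by rewrite lip// mj.
  by rewrite subr_ge0 ler_pM2r// ler_nat.
have hd : mesh n <= d by near: n; exact: mesh_small.
have nl : `|l t - a n (node n t)| <= e / 2 by near: n.
have := lipn i (node n t) ni (node_le n tI).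
have nt := node_close n tI.
have : `|i%:R * mesh n - (node n t)%:R * mesh n| <= d + mesh n *+ 2.
  apply: le_trans (ler_distD t _ _) _; apply: lerD => //.
  by rewrite distrC.
rewrite mulr2n => h1 h2.
apply: le_trans (ler_distD (a n (node n t)) _ _) _.
rewrite (distrC _ (l t)).
have h3 : L * `|i%:R * mesh n - (node n t)%:R * mesh n| <= L * (4 * d).
  by rewrite ler_wpM2l//; lra.
have h4 : L * (4 * d) <= e / 2.
  have -> : e = d * (8 * (L + 1)) by rewrite /d divfK// gt_eqF.
  have : 0 <= L * d by rewrite mulr_ge0// ltW.
  lra.
lra.
Unshelve. all: by end_near. Qed.

(** Between the nodes of [t] and [s] all slopes of the polygon are within [e] of
    [G t], so that its increment differs from [(s - t) *: G t] by at most
    [e * `|s - t|]; this passes to the limit. The continuity of [G] is read off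
    one node close to both [s] and [t], at a single late index. *)
Lemma polygon_C1 (z g : nat -> nat -> X) (Z G : R -> X) :
  (forall n i, z n i.+1 = z n i + mesh n *: g n i) ->
  (forall t, unit_interval R t -> z n (node n t) @[n --> U] --> Z t) ->
  locally_close g G -> C1_within (unit_interval R) Z G.
Proof.
move=> zS zZ gG; split; last first.
  apply/subspace_continuousP => t tI; apply/cvgrPdist_le => e e0.
  have e2 : 0 < e / 2 by rewrite divr_gt0.
  have [d d0 dP] := gG t _ tI e2.
  have d2 : 0 < d / 2 by rewrite divr_gt0.
  apply/nbhs_ballP; exists (d / 2) => //= s; rewrite -ball_normE /= => ts sI.
  have [d' d'0 d'P] := gG s _ sI e2.
  have m0 : 0 < Num.min (d' / 2) (d / 4) by rewrite lt_min !divr_gt0.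
  have [n [[nt ns] nm]] := filter_ex (filterI (filterI dP d'P) (mesh_small m0)).
  move: nm; rewrite le_min => /andP[nm nm'].
  have nc := node_close n sI; rewrite mulr2n in nc.
  have h1 : `|g n (node n s) - G s| <= e / 2 by apply: ns; [exact: node_le|lra].
  have h2 : `|g n (node n s) - G t| <= e / 2.
    apply: nt; first exact: node_le.
    apply: le_trans (ler_distD s _ _) _; rewrite (distrC s); lra.
  apply: le_trans (ler_distD (g n (node n s)) _ _) _; rewrite distrC; lra.
move=> t tI; apply/cvgrPdist_le => e e0.
have [d d0 dP] := gG t e tI e0.
have d2 : 0 < d / 2 by rewrite divr_gt0.
apply/nbhs_ballP; exists (d / 2) => //= s; rewrite -ball_normE /= => ts st sI.
have st0 : s - t != 0 by rewrite subr_eq0.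
suff key : `|Z s - Z t - (s - t) *: G t| <= `|s - t| * e.
  have -> : G t - (s - t)^-1 *: (Z s - Z t) =
            - ((s - t)^-1 *: (Z s - Z t - (s - t) *: G t)).
    by move: (Z s - Z t) => D; rewrite scalerBr scalerA mulVf// scale1r opprB.
  rewrite normrN normrZ normfV mulrC ler_pdivrMr ?normr_gt0// mulrC //.
have nodeC r : unit_interval R r -> (node n r)%:R * mesh n @[n --> U] --> r.
  move=> rI; apply/cvgrPdist_le => e1 e10.
  have e12 : 0 < e1 / 2 by rewrite divr_gt0.
  near=> n; rewrite distrC; apply: le_trans (node_close n rI) _.
  have : mesh n <= e1 / 2 by near: n; exact: mesh_small.
  by rewrite (mulr2n (mesh n)); lra.
have discrete : \forall n \near U,
    `|z n (node n s) - z n (node n t) -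
        ((node n s)%:R * mesh n - (node n t)%:R * mesh n) *: G t|
    <= `|(node n s)%:R * mesh n - (node n t)%:R * mesh n| * e.
  have d4 : 0 < d / 4 by rewrite divr_gt0.
  near=> n.
  have hd : mesh n <= d / 4 by near: n; exact: mesh_small.
  have h0 := mesh_gt0 n.
  have gn : forall i, (i <= n)%N -> `|i%:R * mesh n - t| <= d -> `|g n i - G t| <= e.
    by near: n.
  have cs := node_close n sI; have ct := node_close n tI; rewrite !mulr2n in cs ct.
  have sn := node_le n sI; have tn := node_le n tI.
  have bt m : (m%:R : R) * mesh n - t <= d -> - d <= m%:R * mesh n - t -> (m <= n)%N ->
      `|g n m - G t| <= e.
    by move=> ? ? mn; apply: gn => //; rewrite ler_norml; apply/andP.
  have [le|/ltnW le] := leqP (node n t) (node n s).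
    rewrite [X in X * e]ger0_norm; last by rewrite subr_ge0 ler_pM2r// ler_nat.
    rewrite -!mulrBl; apply: polygon_diff => //; first exact: ltW.
    move=> m /andP[m1 m2]; split=> //.
    have : (node n t)%:R * mesh n <= m%:R * mesh n by rewrite ler_pM2r// ler_nat.
    have : m%:R * mesh n <= (node n s)%:R * mesh n by rewrite ler_pM2r// ler_nat ltnW.
    move: cs ct ts; rewrite !ler_norml ltr_norml => /andP[? ?] /andP[? ?] /andP[? ?] ? ?.
    apply: bt; [lra|lra|exact: leq_trans (ltnW m2) sn].
  rewrite [X in X * e]ler0_norm; last by rewrite subr_le0 ler_pM2r// ler_nat.
  have := @polygon_diff (z n) (g n) (mesh n) e (G t) _ _ (ltW h0) le.
  rewrite opprB -!mulrBl; set A := z n (node n s); set B := z n (node n t).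
  have -> : A - B - (((node n s)%:R - (node n t)%:R) * mesh n) *: G t =
      - (B - A - (((node n t)%:R - (node n s)%:R) * mesh n) *: G t).
    by rewrite 2!opprB [RHS]addrC -scaleNr -mulNr opprB.
  rewrite normrN; apply=> m /andP[m1 m2]; split=> //.
  have : (node n s)%:R * mesh n <= m%:R * mesh n by rewrite ler_pM2r// ler_nat.
  have : m%:R * mesh n <= (node n t)%:R * mesh n by rewrite ler_pM2r// ler_nat ltnW.
  move: cs ct ts; rewrite !ler_norml ltr_norml => /andP[? ?] /andP[? ?] /andP[? ?] ? ?.
  apply: bt; [lra|lra|exact: leq_trans (ltnW m2) tn].
have lim1 : z n (node n s) - z n (node n t) -
        ((node n s)%:R * mesh n - (node n t)%:R * mesh n) *: G t @[n --> U]
     --> Z s - Z t - (s - t) *: G t.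
  apply: cvgB; first by apply: cvgB; exact: zZ.
  by apply: cvgZl; apply: cvgB; exact: nodeC.
have lim2 : `|(node n s)%:R * mesh n - (node n t)%:R * mesh n| * e @[n --> U] --> `|s - t| * e.
  by apply: cvgMl; apply: cvg_norm; apply: cvgB; exact: nodeC.
exact: (ler_cvg_to (cvg_norm lim1) lim2 discrete).
Unshelve. all: by end_near. Qed.

End PolygonLimit.

(** * Shooting with Euler polygons *)

Section Shooting.
Context {R : realType} {X : completeNormedModType R}.
Variables (phi psi : X -> X) (k c0 c1 L M : R) (F : R -> X -> X -> X) (K W : set X).
Hypotheses (phi_cont : continuous phi) (psiK : cancel psi phi) (psi0 : psi 0 = 0).
Hypotheses (k_gt0 : 0 < k) (psi_lip : forall x y, `|psi x - psi y| <= k * `|x - y|).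
Hypothesis F_cont : continuous (fun p : R * X * X => F p.1.1 p.1.2 p.2).
Hypotheses (c0_ge0 : 0 <= c0) (c1_ge0 : 0 <= c1).
Hypothesis F_growth : forall t x y, `|F t x y| <= c0 + c1 * `|y|.
Hypothesis F_bounded : forall t x y, `|F t x y| <= L.
Hypotheses (K_compact : compact K) (K_convex : convex K) (K0 : K 0).
Hypothesis K_bounded : forall x, K x -> `|x| <= M.
Hypothesis K_covered : forall d, 0 < d -> covered d K.
Hypotheses (W_convex : convex W) (W0 : W 0) (WK : forall w, W w -> K (psi w)).
Hypothesis FW : forall t p q y, K p -> K q -> K y -> W (F t (p - q) y).

(** Euler's method for the system [u' = psi w], [w' = F t u (psi w)], started
    from [u = - b] and [w = 0]. *)
Fixpoint euler n (b : X) i : X * X :=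
  if i is j.+1 then
    let s := euler n b j in
    (s.1 + mesh n *: psi s.2, s.2 + mesh n *: F (j%:R * mesh n) s.1 (psi s.2))
  else (- b, 0).

(** The sum of all increments of [u], which has to equal [b] for [u] to vanish
    at time [1]. *)
Definition shot n b : X := b + (euler n b n.+1).1.

Let M0 : 0 <= M.
Proof. exact: le_trans (K_bounded K0). Qed.

Let L0 : 0 <= L.
Proof. exact: le_trans (F_bounded 0 0 0). Qed.

Let psi_cont : continuous psi.
Proof.
move=> x; apply/cvgrPdist_le => e e0; apply/nbhs_ballP.
exists (e / k) => /= [|y]; first by rewrite divr_gt0.
rewrite -ball_normE /= => /ltW xy; apply: le_trans (psi_lip _ _) _.
by rewrite mulrC -ler_pdivlMr.
Qed.

(** The partial sums of the increments are averages, scaled by the elapsed time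
    [i%:R * mesh n <= 1], of elements of convex sets containing [0]. *)
Lemma euler_in n b i : K b -> (i <= n.+1)%N ->
  [/\ exists2 p, K p & (euler n b i).1 = (i%:R * mesh n) *: p - b,
      exists2 q, W q & (euler n b i).2 = (i%:R * mesh n) *: q &
      K (psi (euler n b i).2)].
Proof.
move=> Kb; elim: i => [|i IH] i_n.
  split; first by exists 0 => //; rewrite scaler0 sub0r.
    by exists 0 => //; rewrite scaler0.
  by rewrite /= psi0.
have [[p Kp Ep] [q Wq Eq] Kv] := IH (ltnW i_n).
have h0 : 0 <= mesh n :> R by exact: ltW (mesh_gt0 n).
have ih0 : 0 <= i%:R * mesh n :> R by rewrite mulr_ge0.
have Ei : i.+1%:R * mesh n = i%:R * mesh n + mesh n :> R.
  by rewrite -natr1 mulrDl mul1r.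
have WF : W (F (i%:R * mesh n) (euler n b i).1 (psi (euler n b i).2)).
  by rewrite Ep; apply: FW => //; apply: convex_scale => //; exact: node_itv (ltnW _).
have [p' Kp' Ep'] := convex_add K_convex Kp Kv ih0 h0.
have [q' Wq' Eq'] := convex_add W_convex Wq WF ih0 h0.
have E2 : (euler n b i.+1).2 = (i.+1%:R * mesh n) *: q' by rewrite /= Ei -Eq' -Eq.
split; [exists p' => //|by exists q'|].
  by rewrite /= Ei -Ep' Ep addrAC.
by rewrite E2; apply: WK; apply: convex_scale => //; exact: node_itv.
Qed.

Lemma shot_in n b : K b -> K (shot n b).
Proof.
move=> Kb; have [[p Kp Ep] _ _] := euler_in Kb (leqnn n.+1).
rewrite /shot Ep addrC subrK; apply: convex_scale => //; exact: node_itv.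
Qed.

Lemma euler_cont n i : continuous (fun b => euler n b i).
Proof.
elim: i => [|i IH] b /=.
  by apply: cvg_pair; [apply: continuousN; exact: cvg_id|exact: cvg_cst].
have c1' : (euler n x i).1 @[x --> b] --> (euler n b i).1.
  by apply: cvg_comp (IH b) _; exact: cvg_fst.
have c2' : (euler n x i).2 @[x --> b] --> (euler n b i).2.
  by apply: cvg_comp (IH b) _; exact: cvg_snd.
have cv : psi (euler n x i).2 @[x --> b] --> psi (euler n b i).2.
  by apply: cvg_comp c2' _; exact: psi_cont.
apply: cvg_pair => /=.
  by apply: cvgD => //; apply: cvgZr.
apply: cvgD => //; apply: cvgZr.
set t : R := i%:R * mesh n.
have ct : (cst t : X -> R) @ nbhs b --> t by exact: cvg_cst.
have cp1 := cvg_pair (FF := nbhs_filter b) (FG := nbhs_filter t)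
  (FH := nbhs_filter (euler n b i).1) ct c1'.
have cp := cvg_pair (FF := nbhs_filter b) (FG := nbhs_filter (t, (euler n b i).1))
  (FH := nbhs_filter (psi (euler n b i).2)) cp1 cv.
exact: cvg_comp cp (@F_cont ((t, (euler n b i).1), psi (euler n b i).2)).
Qed.

Lemma shot_cont n : continuous (shot n).
Proof.
move=> b; have c : (euler n x n.+1).1 @[x --> b] --> (euler n b n.+1).1.
  have c' : euler n x n.+1 @[x --> b] --> euler n b n.+1 by exact: euler_cont.
  by apply: (cvg_comp _ fst c'); exact: cvg_fst.
by apply: cvgD => //; exact: cvg_id.
Qed.

Lemma near_miss n : exists2 b, K b & `|shot n b - b| <= mesh n.
Proof.
apply: (@approximate_fixed_point _ _ K (shot n) M) => //.
- by exists 0.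
- exact: shot_in.
- by move=> e /K_covered/covered_net.
- move=> e /(uniform_continuity_compact K_compact (@shot_cont n))[d d0 dP].
  by exists d => // x y Kx _; exact: dP.
- exact: mesh_gt0.
Qed.

(** Gronwall's inequality for the polygons; the induction carries the elapsed
    time [i%:R * mesh n] both as a factor and in the exponent. *)
Lemma euler_growth n b i : (i <= n.+1)%N ->
  `|(euler n b i).2| <= c0 * expR (c1 * k).
Proof.
move=> i_n.
have psi_le x : `|psi x| <= k * `|x| by have := psi_lip x 0; rewrite psi0 !subr0.
pose E j := expR (c1 * k * (j%:R * mesh n)).
suff H : `|(euler n b i).2| <= c0 * (i%:R * mesh n) * E i.
  apply: le_trans H _; have /andP[h0 h1] := @node_itv R _ _ i_n.
  rewrite -mulrA ler_wpM2l//.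
  apply: (@le_trans _ _ (E i)); first by rewrite ler_piMl// expR_ge0.
  by rewrite ler_expR ler_piMr// mulr_ge0// ltW.
elim: i {i_n} => [|i IH]; first by rewrite /= normr0 mul0r mulr0 mul0r.
have h0 := mesh_gt0 (R := R) n; set h := mesh n in h0 IH *.
rewrite /= -/h; apply: le_trans (ler_normD _ _) _.
rewrite normrZ (gtr0_norm h0).
have iS : i.+1%:R * h = i%:R * h + h by rewrite -natr1 mulrDl mul1r.
have step : (1 + c1 * k * h) * E i <= E i.+1.
  by rewrite /E iS mulrDr expRD mulrC ler_wpM2l ?expR_ge0// expR_ge1Dx.
have E1 : 1 <= E i.+1.
  apply: le_trans (expR_ge1Dx _); rewrite lerDl !mulr_ge0//; exact: ltW.
set w := (euler n b i).2 in IH *.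
have Fw : `|F (i%:R * h) (euler n b i).1 (psi w)| <= c0 + c1 * (k * `|w|).
  by apply: le_trans (F_growth _ _ _) _; rewrite lerD2l ler_wpM2l.
have h1 : h * `|F (i%:R * h) (euler n b i).1 (psi w)| <= h * (c0 + c1 * (k * `|w|)).
  by rewrite ler_wpM2l// ltW.
have h2 : (1 + c1 * k * h) * `|w| <= c0 * (i%:R * h) * E i.+1.
  apply: le_trans (_ : (1 + c1 * k * h) * (c0 * (i%:R * h) * E i) <= _).
    by rewrite ler_wpM2l// addr_ge0// !mulr_ge0// ltW.
  by rewrite mulrCA ler_wpM2l// !mulr_ge0// ltW.
have h3 : h * c0 <= c0 * h * E i.+1.
  by rewrite [leLHS]mulrC ler_peMr// mulr_ge0// ltW.
rewrite iS mulrDr mulrDl.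
lra.
Qed.

(** For each mesh take a polygon that misses the condition at time [1] by at most
    [mesh n]. The values of [u] and [psi w] lie in the compact set [K], up to the
    shift of [u] by [b n], so that they converge along an ultrafilter at every
    [t] at once. The
    polygons are Lipschitz uniformly in the mesh, which upgrades this to
    [locally_close], and [polygon_C1] applies to both components. *)
Lemma shooting_limit : exists u v : R -> X,
  [/\ C1_within (unit_interval R) u v,
      C1_within (unit_interval R) (phi \o v) (fun t => F t (u t) (v t)),
      u 1 = 0, v 0 = 0 &
      forall t, unit_interval R t -> `|v t| <= k * (c0 * expR (c1 * k))].
Proof.
have near_miss' n : exists b, K b /\ `|shot n b - b| <= mesh n.
  by have [b ? ?] := near_miss n; exists b.
have {near_miss'}[b bP] := choice near_miss'.
pose u_ n i := (euler n (b n) i).1; pose w_ n i := (euler n (b n) i).2.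
pose v_ n i := psi (w_ n i).
pose g_ n i := F (i%:R * mesh n) (u_ n i) (v_ n i).
have [U [UU U_oo]] := ultraFilterLemma (eventually_filter : ProperFilter \oo).
have inK n i : (i <= n.+1)%N -> K (u_ n i + b n) /\ K (v_ n i).
  move=> i_n; have [Kb _] := bP n.
  have [[p Kp Ep] _ Kv] := euler_in Kb i_n; split=> //.
  rewrite /u_ Ep subrK; apply: convex_scale => //; exact: node_itv.
have node_n n t : unit_interval R t -> (node n t <= n.+1)%N.
  by move=> /(node_le n)/leq_trans; apply.
have lip (a g : nat -> nat -> X) (B : R) :
    (forall n i, a n i.+1 = a n i + mesh n *: g n i) ->
    (forall n i, (i <= n)%N -> `|g n i| <= B) ->
    forall n i j, (i <= j <= n)%N ->
    `|a n j - a n i| <= B * (j%:R * mesh n - i%:R * mesh n).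
  move=> aS gB n i j /andP[ij jn].
  have := @polygon_diff _ _ (a n) (g n) (mesh n) B 0 i j (ltW (mesh_gt0 n)) ij.
  rewrite scaler0 subr0 mulrC -mulrBl; apply=> m /andP[_ mj]; split=> //.
  by rewrite subr0 gB// (leq_trans (ltnW mj)).
have bnd_v n i : (i <= n)%N -> `|v_ n i| <= M.
  by move=> i_n; apply: K_bounded; have [] := inK n i (leqW i_n).
have [b0 _ lim_b] := ultra_limit UU K_compact (fun n => proj1 (bP n)).
have ex_v t : exists l : X, unit_interval R t -> v_ n (node n t) @[n --> U] --> l.
  have [tI|ntI] := pselect (unit_interval R t); last by exists 0 => /ntI.
  have [l _ lim_l] := ultra_limit UU K_compact (fun n => proj2 (inK n _ (node_n n t tI))).
  by exists l.
have [v lim_v] := choice ex_v.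
have ex_u t : exists l : X, unit_interval R t -> u_ n (node n t) @[n --> U] --> l.
  have [tI|ntI] := pselect (unit_interval R t); last by exists 0 => /ntI.
  have [l _ lim_l] := ultra_limit UU K_compact (fun n => proj1 (inK n _ (node_n n t tI))).
  exists (l - b0) => _; under eq_fun => n do rewrite -[u_ _ _](addrK (b n)).
  exact: cvgB.
have [u lim_u] := choice ex_u.
have u_S n i : u_ n i.+1 = u_ n i + mesh n *: v_ n i by [].
have w_S n i : w_ n i.+1 = w_ n i + mesh n *: g_ n i by [].
have close_u : locally_close U u_ u.
  by apply: (@locally_close_lipschitz _ _ _ _ U_oo _ _ M) => //; exact: lip bnd_v.
have close_v : locally_close U v_ v.
  apply: (@locally_close_lipschitz _ _ _ _ U_oo _ _ (k * L)) => //.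
    by rewrite mulr_ge0// ltW.
  move=> n i j ijn; apply: le_trans (psi_lip _ _) _; rewrite -mulrA ler_wpM2l ?(ltW k_gt0)//.
  by apply: (lip w_ g_) => // m l _; exact: F_bounded.
have close_g : locally_close U g_ (fun t => F t (u t) (v t)).
  move=> t e tI e0.
  have /cvgrPdist_le/(_ _ e0)/nbhs_ballP[r /= r0 rP] := @F_cont ((t, u t), v t).
  have r2 : 0 < r / 2 by rewrite divr_gt0.
  have [d1 d10 d1P] := close_u t _ tI r2; have [d2 d20 d2P] := close_v t _ tI r2.
  exists (Num.min (r / 2) (Num.min d1 d2)); first by rewrite !lt_min r2 d10.
  near=> n => i i_n; rewrite !le_min => /and3P[it it1 it2].
  have un : `|u_ n i - u t| <= r / 2.
    by move: i i_n it it1 it2; near: n; apply: filterS d1P => n H i i_n _ it _; exact: H.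
  have vn : `|v_ n i - v t| <= r / 2.
    by move: i i_n it it1 it2 un; near: n; apply: filterS d2P => n H i i_n _ _ it _; exact: H.
  rewrite distrC; apply: (rP ((i%:R * mesh n, u_ n i), v_ n i)).
  split; [split|] => /=; rewrite -ball_normE /= distrC.
  - by apply: le_lt_trans it _; lra.
  - by apply: le_lt_trans un _; lra.
  - by apply: le_lt_trans vn _; lra.
have small_end n : `|u_ n n| <= mesh n * (1 + M).
  have [_ miss] := bP n; have := u_S n n.
  have -> : u_ n n.+1 = shot n (b n) - b n by rewrite /shot addrAC subrr add0r.
  move=> /esym/(canRL (addrK _)) ->; apply: le_trans (ler_normB _ _) _.
  rewrite mulrDr mulr1 lerD// normrZ gtr0_norm ?mesh_gt0// ler_wpM2l ?bnd_v//.
  exact: ltW (mesh_gt0 n).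
exists u, v; split.
- exact: (polygon_C1 U_oo u_S lim_u close_v).
- apply: (polygon_C1 U_oo w_S _ close_g) => t tI.
  under eq_fun => n do rewrite -[w_ _ _]psiK.
  by apply: cvg_comp (lim_v t tI) _; exact: phi_cont.
- have tI : unit_interval R 1 by rewrite /unit_interval/= in_itv/= ler01 lexx.
  apply/eqP; rewrite -normr_le0; apply/ler_addgt0Pr => e e0; rewrite add0r.
  have e2 : 0 < e / 2 by rewrite divr_gt0.
  have eM : 0 < e / 2 / (1 + M) by rewrite divr_gt0// ltr_wpDr.
  have /cvgrPdist_le/(_ _ e2) lim1 := lim_u 1 tI.
  have [n [n1 n2]] := filter_ex (filterI lim1 (mesh_small U_oo eM)).
  move: n1; rewrite /node mul1r natrK => n1.
  rewrite -(subrK (u_ n n) (u 1)); apply: le_trans (ler_normD _ _) _.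
  rewrite [leRHS](splitr e); apply: lerD => //.
  by apply: le_trans (small_end n) _; rewrite -ler_pdivlMr// ltr_wpDr.
- have tI : unit_interval R 0 by rewrite /unit_interval/= in_itv/= ler01 lexx.
  have := lim_v 0 tI; under eq_fun => n do rewrite /node mul0r truncn0 /v_ /w_ /= psi0.
  by move=> lim0; apply: (cvg_unique _ lim0 (cvg_cst _)).
- move=> t tI; apply: (ler_cvg_to (cvg_norm (lim_v t tI)) (cvg_cst _)).
  apply: filterE => n; have := psi_lip (w_ n (node n t)) 0; rewrite psi0 !subr0.
  move/le_trans; apply; rewrite ler_wpM2l ?(ltW k_gt0)//.
  by apply: euler_growth; exact: node_n.
Unshelve. all: by end_near. Qed.

End Shooting.

(** * Truncation of the nonlinearity *)

Section Truncation.
Context {R : realType} {X : normedModType R}.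

(** The radial retraction onto the ball of radius [M]. It multiplies by a factor
    between [0] and [1], and thus maps a convex set containing [0] to itself. *)
Definition radial (M : R) (y : X) : X := (M / Num.max M `|y|) *: y.

Definition clamp (t : R) : R := Num.max 0 (Num.min 1 t).

Lemma clamp_itv t : unit_interval R (clamp t).
Proof.
rewrite /unit_interval/= in_itv/= /clamp le_max lexx/= ge_max ler01/=.
by rewrite ge_min lexx.
Qed.

Lemma clamp_id t : unit_interval R t -> clamp t = t.
Proof.
rewrite /unit_interval/= in_itv/= => /andP[t0 t1].
by rewrite /clamp min_r// max_r.
Qed.

Lemma clamp_cont : continuous clamp.
Proof.
move=> t; apply: continuous_max; first exact: cvg_cst.
by apply: continuous_min; [exact: cvg_cst|exact: cvg_id].
Qed.

Variable M : R.
Hypothesis M0 : 0 < M.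

Let max_gt0 (y : X) : 0 < Num.max M `|y|.
Proof. by rewrite lt_max M0. Qed.

Lemma radial_scale (y : X) : 0 <= M / Num.max M `|y| <= 1.
Proof.
rewrite divr_ge0 ?(ltW M0) ?(ltW (max_gt0 y))//=.
by rewrite ler_pdivrMr// mul1r le_max lexx.
Qed.

Lemma radial_norm (y : X) : `|radial M y| <= `|y|.
Proof.
have /andP[h0 h1] := radial_scale y.
by rewrite /radial normrZ ger0_norm// ler_piMl.
Qed.

Lemma radial_bounded (y : X) : `|radial M y| <= M.
Proof.
have /andP[h0 h1] := radial_scale y.
rewrite /radial normrZ ger0_norm// mulrAC ler_pdivrMr//.
by rewrite ler_pM2l// le_max lexx orbT.
Qed.

Lemma radial_id (y : X) : `|y| <= M -> radial M y = y.
Proof. by move=> yM; rewrite /radial max_l// divff ?gt_eqF// scale1r. Qed.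

Lemma radial_cont : continuous (radial M).
Proof.
move=> y; apply: cvgZ; last exact: cvg_id.
apply: cvgM; first exact: cvg_cst.
apply: cvgV; first by rewrite gt_eqF.
apply: continuous_max; [exact: cvg_cst|exact: norm_continuous].
Qed.

End Truncation.

(** * A compact convex set for the shooting *)

Section CompactInvariant.
Context {R : realType} {X : completeNormedModType R}.
Variables (psi : X -> X) (k k1 M B : R) (f : R * X * X -> X).
Hypotheses (k_gt0 : 0 < k) (psi0 : psi 0 = 0).
Hypothesis psi_lip : forall x y, `|psi x - psi y| <= k * `|x - y|.
Hypotheses (M_gt0 : 0 < M) (k1_gt0 : 0 < k1) (k1_lt : k1 < (2 * k)^-1).
Hypothesis f_bounded : forall t x y, unit_interval R t -> `|y| <= M -> `|f (t, x, y)| <= B.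
Hypothesis f_kuratowski : forall A C : set X, bounded_set A -> bounded_set C ->
  kuratowski (f @` (unit_interval R `*` A `*` C)) <=
    k1 * Num.max (kuratowski A) (kuratowski C).

Definition differences (A : set X) := [set p.1 - p.2 | p in A `*` A].
Definition truncated_values (A : set X) : set X :=
  f @` (unit_interval R `*` differences A `*` (radial M @` A)).

(** This set contains the Riemann sums, over subintervals of the unit interval,
    of functions with values in [truncated_values A]. *)
Definition integrals (A : set X) : set X := hull (0 |` truncated_values A).

(** By [minimal_invariant], [K] is the closed hull of [0] and [psi @` integrals K].
    The measure of noncompactness ignores closed hulls and finite sets, is at
    most doubled by passing from [K] to its differences, and is not increased by
    [radial], which maps [K] to itself. With [a = kuratowski K] this gives
    [a <= k * k1 * (2 * a)], where [2 * k * k1 < 1]; hence [a = 0]. *)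
Lemma compact_invariant : exists K : set X,
  [/\ compact K, convex K /\ K 0, forall w, integrals K w -> K (psi w),
      forall x, K x -> `|x| <= k * B & forall d, 0 < d -> covered d K].
Proof.
have B0 : 0 <= B.
  apply: le_trans (normr_ge0 (f (0, 0, 0))) (f_bounded _ _ _).
    by rewrite /unit_interval/= in_itv/= lexx ler01.
  by rewrite normr0 ltW.
have kB0 : 0 <= k * B by rewrite mulr_ge0// ltW.
have values_bounded A y : (0 |` truncated_values A) y -> `|y| <= B.
  move=> [->|[[[t x] z] [[/= tI _] [z' _ <-]] <-]]; first by rewrite normr0.
  by apply: f_bounded => //; exact: radial_bounded.
have mono A C : A `<=` C -> psi @` integrals A `<=` psi @` integrals C.
  move=> AC; apply: image_subset; apply: hull_mono => y [->|]; first by left.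
  move=> [[[t x] z] [[/= tI [[p q] [/= Ap Aq] Ex]] [z' Az Ez]] <-]; right.
  exists (t, x, z) => //; split; last by exists z' => //; exact: AC.
  by split=> //; exists (p, q) => //; split; exact: AC.
have [|K [clK [cK K0] psiK Kmin KM]] :=
    @minimal_invariant _ _ (fun A => psi @` integrals A) (k * B) kB0 mono.
  move=> A _ _ [w hw <-]; have := psi_lip w 0; rewrite psi0 !subr0 => /le_trans; apply.
  by rewrite ler_wpM2l ?(ltW k_gt0)//; apply: hull_bounded hw => y /values_bounded.
pose a := kuratowski K.
have bounded_le (A : set X) (r : R) : (forall x, A x -> `|x| <= r) -> bounded_set A.
  move=> Ar; exists r; split; first exact: num_real.
  by move=> r' rr' x Ax; exact: le_trans (Ar x Ax) (ltW rr').
(* d stands for a and e absorbs the losses of the covers *)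
have step d e : a < d -> 0 < e -> a <= k * (k1 * (d + d) + e + e) + e.
  move=> ad e0.
  have d0 : 0 < d by apply: le_lt_trans ad; exact: kuratowski_ge0.
  have cd : covered d K by exact: (covered_kuratowski KM ad).
  have ka : kuratowski (truncated_values K) <= k1 * (d + d).
    apply: le_trans (f_kuratowski _ _) _.
    - apply: (bounded_le _ (k * B + k * B)) => _ [[p q] [/= Kp Kq] <-].
      by apply: le_trans (ler_normB _ _) _; apply: lerD; exact: KM.
    - by apply: (bounded_le _ M) => _ [y _ <-]; exact: radial_bounded.
    rewrite ler_wpM2l ?(ltW k1_gt0)// ge_max; apply/andP; split.
      by apply: kuratowski_le; [exact: addr_gt0|exact: covered_diff].
    apply: kuratowski_le; first exact: addr_gt0.
    apply: (@covered_le _ _ d); first by rewrite lerDl ltW.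
    apply: covered_sub cd => _ [y Ky <-].
    by apply: convex_scale => //; exact: radial_scale.
  have d1 : 0 <= k1 * (d + d) by rewrite mulr_ge0 ?addr_ge0// ltW.
  have e1 : 0 <= k1 * (d + d) + e by rewrite addr_ge0// ltW.
  have e2 : 0 <= k1 * (d + d) + e + e by rewrite addr_ge0// ltW.
  have c1 : covered (k1 * (d + d) + e) (0 |` truncated_values K).
    apply: covered_setU1 => //; apply: (@covered_kuratowski _ _ _ _ B).
      by move=> y Ky; apply: (values_bounded K); right.
    by apply: le_lt_trans ka _; rewrite ltrDl.
  have c2 : covered (k1 * (d + d) + e + e) (integrals K).
    apply: covered_sub (@covered_closed_hull _ _ _ e B _ (@values_bounded K) _ e0 c1).
      by move=> w hw C _; exact: hw.
    by exists 0; left.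
  have c3 : covered (k * (k1 * (d + d) + e + e)) (0 |` (psi @` integrals K)).
    apply: covered_setU1; first by rewrite mulr_ge0 ?(ltW k_gt0).
    by apply: covered_lipschitz => //; exact: ltW.
  apply: kuratowski_le; first by rewrite ltr_wpDl// mulr_ge0 ?(ltW k_gt0).
  apply: covered_sub Kmin _; apply: (@covered_closed_hull _ _ _ e (k * B)) => //.
    by move=> y [->|/psiK/KM//]; rewrite normr0.
  by exists 0; left.
have a0 : a = 0.
  apply/eqP; rewrite eq_le kuratowski_ge0 andbT leNgt; apply/negP => agt0.
  pose q := 2 * k * k1.
  have q1 : q < 1.
    by rewrite /q -ltr_pdivlMl ?mulr_gt0// mulr1.
  pose gap := a - q * a.
  have gap0 : 0 < gap by rewrite subr_gt0 -[ltRHS]mul1r ltr_pM2r.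
  have k20 : 0 < 2 * k + 1 by rewrite addr_gt0// mulr_gt0.
  pose e := gap / 4 / (2 * k + 1).
  have e0 : 0 < e by rewrite !divr_gt0.
  have Ee : e * (2 * k + 1) = gap / 4 by rewrite /e divfK// gt_eqF.
  have := step (a + gap / 4) e _ e0; rewrite ltrDl divr_gt0// => /(_ isT).
  have -> : k * (k1 * (a + gap / 4 + (a + gap / 4)) + e + e) + e =
            q * a + q * (gap / 4) + e * (2 * k + 1) by rewrite /q; ring.
  have : q * (gap / 4) <= gap / 4 by rewrite ler_piMl ?(ltW q1)// divr_ge0// ltW.
  rewrite Ee; move: gap0; rewrite /gap; lra.
have covK d : 0 < d -> covered d K.
  by move=> d0; apply: (covered_kuratowski KM); rewrite -/a a0.
exists K; split=> //; first exact: compact_covered.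
by move=> w Iw; apply: psiK; exists w.
Qed.

End CompactInvariant.

(** * Existence of a solution *)

Unset Implicit Arguments.

Theorem theorem4p2 (R : realType) (X : completeNormedModType R)
    (phi phi_inv : X -> X) (k : R) (f : R * X * X -> X)
    (phi_homeo : homeomorphism phi phi_inv)
    (phi0 : phi 0 = 0)
    (k_gt0 : 0 < k)
    (phi_inv_lip : k.-lipschitz phi_inv)
    (f_cont : {within unit_interval R `*` [set: X] `*` [set: X], continuous f})
    (f_growth : exists c0 c1 : R, [/\ 0 <= c0, 0 <= c1 &
       forall (t : R) (x y : X), unit_interval R t ->
         `|f (t, x, y)| <= c0 + c1 * `|y|])
    (f_kuratowski : exists k1 : R, [/\ 0 < k1, k1 < (2 * k)^-1 &
       forall A B : set X, bounded_set A -> bounded_set B ->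
         kuratowski (f @` (unit_interval R `*` A `*` B))
           <= k1 * Num.max (kuratowski A) (kuratowski B)]) :
  exists u : R -> X, bvp_solution phi f u.
Proof.
have [phi_cont inv_cont phiK phi_invK] := phi_homeo.
have [c0 [c1 [c00 c10 growth]]] := f_growth.
have [k1 [k10 k1k f_k]] := f_kuratowski.
have inv0 : phi_inv 0 = 0 by rewrite -phi0 phiK.
have inv_lip x y : `|phi_inv x - phi_inv y| <= k * `|x - y|.
  exact: (phi_inv_lip (x, y)).
pose M := k * (c0 * expR (c1 * k)) + 1.
have M0 : 0 < M by rewrite ltr_wpDl// !mulr_ge0 ?expR_ge0// ltW.
have f_bnd t x y : unit_interval R t -> `|y| <= M -> `|f (t, x, y)| <= c0 + c1 * M.
  by move=> tI yM; apply: le_trans (growth _ _ _ tI) _; rewrite lerD2l ler_wpM2l.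
have [K [cK [cvxK K0] KW KM covK]] :=
  compact_invariant k_gt0 inv0 inv_lip M0 k10 k1k f_bnd f_k.
(* M exceeds the bound for v that the growth of f implies, so that the
   truncation is invisible along the solution found *)
pose F t x y := f (clamp t, x, radial M y).
have F_cont : continuous (fun p : R * X * X => F p.1.1 p.1.2 p.2).
  pose h (p : R * X * X) : R * X * X := (clamp p.1.1, p.1.2, radial M p.2).
  pose A := unit_interval R `*` [set: X] `*` [set: X].
  have hA p : A (h p) by do 2!split=> //; exact: clamp_itv.
  have h_cont : continuous h.
    move=> p.
    have l1 : q.1.1 @[q --> p] --> p.1.1.
      by apply: (@cvg_comp _ _ _ fst fst) cvg_fst cvg_fst.
    have l2 : q.1.2 @[q --> p] --> p.1.2.
      by apply: (@cvg_comp _ _ _ fst snd) cvg_fst cvg_snd.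
    have c1' : clamp q.1.1 @[q --> p] --> clamp p.1.1.
      by apply: cvg_comp l1 _; exact: clamp_cont.
    have c2' : radial M q.2 @[q --> p] --> radial M p.2.
      by apply: cvg_comp cvg_snd _; exact: radial_cont.
    have c12 := cvg_pair (FF := nbhs_filter p) (FG := nbhs_filter (clamp p.1.1))
      (FH := nbhs_filter p.1.2) c1' l2.
    exact (cvg_pair (FF := nbhs_filter p) (FG := nbhs_filter (clamp p.1.1, p.1.2))
      (FH := nbhs_filter (radial M p.2)) c12 c2').
  move=> p.
  have fh : f @ within A (nbhs (h p)) --> f (h p).
    by move/subspace_continuousP: f_cont; apply; exact: hA.
  have hw : h @ nbhs p --> within A (nbhs (h p)).
    move=> S /(h_cont p) hS.
    have : nbhs p [set q | A (h q) -> S (h q)] by exact: hS.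
    by apply: filterS => q; apply; exact: hA.
  exact: cvg_comp hw fh.
have F_growth t x y : `|F t x y| <= c0 + c1 * `|y|.
  apply: le_trans (growth _ _ _ (clamp_itv t)) _.
  by rewrite lerD2l ler_wpM2l// radial_norm.
have F_bnd t x y : `|F t x y| <= c0 + c1 * M.
  by apply: f_bnd; [exact: clamp_itv|exact: radial_bounded].
have FW t p q y : K p -> K q -> K y -> integrals M f K (F t (p - q) y).
  move=> Kp Kq Ky; apply: sub_hull; right.
  exists (clamp t, p - q, radial M y) => //; split; last by exists y.
  by split; [exact: clamp_itv|exists (p, q)].
have [u [v [uv vw u1 v0 vM]]] := shooting_limit phi_cont phi_invK inv0 k_gt0 inv_lip
  F_cont c00 c10 F_growth F_bnd cK cvxK K0 KM covK (@convex_hull _ _ _)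
  (sub_hull (or_introl erefl)) KW FW.
exists u, v, (fun t => F t (u t) (v t)); split=> // t tI.
rewrite /F clamp_id// radial_id//; apply: le_trans (vM t tI) _.
by rewrite /M lerDl.
Qed.
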